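(* Let $G$ be an $n$-vertex, $K_{r+1}$-free graph where $r \ge 3$. For every $k \ge 0$, if $G$ is not $k$-path Hamiltonian and $$n \ge \begin{cases} 6k+26 & \text{if } r=3\\ 6k+2r+3 & \text{if } 4 \le r \le 7\\ k+4(k+4)/(r-4)+2r & \text{if } r \ge 8,\end{cases}$$ then $e(G) \leq e(T_r(n-1)) + (k+1)$. The set $\mathcal{J}^k_{n,r}$ is nonempty, and equality holds if and only if $G \in \mathcal{J}^k_{n,r}$ or $G \in \widehat{\mathcal{H}}_{n,r}^{k}$.
   Context: Graphs are finite and simple; $n,r,k$ are integers; $e(G)$ is the number of edges of $G$. $T_r(n)$ is the $n$-vertex, $r$-partite Turán graph: the complete $r$-partite graph on $n$ vertices with part sizes differing by at most 1 (if $n<r$ some parts are empty and it is $K_n$). $K_{a_1,\dots,a_s}$ is the complete multipartite graph with parts of sizes $a_1,\dots,a_s$. An $n$-vertex graph is $k$-path Hamiltonian ($0 \le k \le n-2$) if every path of length (number of edges) at most $k$ is contained in a Hamiltonian cycle. A graph is traceable if it contains a Hamiltonian path. $\mathcal{J}^k_{n,r}$ is the set of $n$-vertex, $K_{r+1}$-free graphs consisting of $T_r(n-1)$ plus one additional vertex of degree $k+1$ whose neighborhood (i.e., the subgraph induced by its set of neighbors) is traceable. $\widehat{\mathcal{H}}_{n,r}^{\ell}$ is the set of all graphs $G$ such that $(G,r,n)$ appears in the following list for the given $\ell$ (it is empty for parameters not listed): - $\ell=-1$: $(K_{4,1,1}, 4, 6)$, $(K_{5,1,1,1}, 4, 8)$;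 - $\ell=0$: $(K_{6,2,2,1},4,11)$, $(K_{4,1,1,1},5,7)$, $(K_{5,1,1,1,1},5,9)$; - $\ell=1$: $(K_{4,1,1,1,1},6,8)$, $(K_{5,2,1,1,1},5,10)$, $(K_{5,1,1,1,1,1},6,10)$; - $\ell=2$: $(K_{6,2,2,2,1}, 5, 13)$, $(K_{5,2,1,1,1,1}, 6, 11)$, $(K_{5,1,1,1,1,1,1}, 7, 11)$, $(K_{4,1,1,1,1,1}, 7, 9)$; - $\ell=3$: $(K_{5,2,1,1,1,1,1}, 7, 12)$; - $\ell=4$: $(K_{6,2,2,2,2,1}, 6, 15)$, $(K_{5,2,2,1,1,1,1}, 7, 13)$; - $\ell=6$: $(K_{6,2,2,2,2,2,1}, 7, 17)$. *)

(* Defs.v *)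
From mathcomp Require Import all_boot all_order all_algebra.

Set Implicit Arguments.
Unset Strict Implicit.
Unset Printing Implicit Defensive.

Record sgraph := SGraph {
  vertex :> finType;
  adj : rel vertex;
  adj_sym : symmetric adj;
  adj_irrefl : irreflexive adj }.

Arguments adj {s}.

Definition edges (G : sgraph) : {set {set G}} :=
  [set [set u.1; u.2] | u in [pred u : G * G | adj u.1 u.2]].

Definition nb_edges (G : sgraph) : nat := #|edges G|.

Definition neighbors (G : sgraph) (v : G) : {set G} := [set x | adj v x].

Definition degree (G : sgraph) (v : G) : nat := #|neighbors v|.

Definition clique (G : sgraph) (S : {set G}) : Prop :=
  {in S &, forall x y, x != y -> adj x y}.

Definition clique_free (s : nat) (G : sgraph) : Prop :=
  forall S : {set G}, #|S| = s -> ~ clique S.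

Definition isomorphic (G H : sgraph) : Prop :=
  exists2 f : G -> H, bijective f & forall x y, adj (f x) (f y) = adj x y.

Section Induced.
Variables (G : sgraph) (S : {set G}).

Definition induced_adj : rel {x : G | x \in S} :=
  fun x y => adj (val x) (val y).

Fact induced_sym : symmetric induced_adj.
Proof. by move=> x y; apply: adj_sym. Qed.

Fact induced_irrefl : irreflexive induced_adj.
Proof. by move=> x; apply: adj_irrefl. Qed.

Definition induced : sgraph := SGraph induced_sym induced_irrefl.

End Induced.

(* The complete multipartite graph K_{a_1,...,a_s} for a = [:: a_1; ...; a_s];
   a vertex is a part index together with an element of that part. *)
Section CompleteMultipartite.
Variable a : seq nat.

Definition multipartite_adj : rel {i : 'I_(size a) & 'I_(nth 0 a i)} :=
  fun x y => tag x != tag y.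

Fact multipartite_sym : symmetric multipartite_adj.
Proof. by move=> x y; rewrite /multipartite_adj eq_sym. Qed.

Fact multipartite_irrefl : irreflexive multipartite_adj.
Proof. by move=> x; rewrite /multipartite_adj eqxx. Qed.

Definition complete_multipartite : sgraph :=
  SGraph multipartite_sym multipartite_irrefl.

End CompleteMultipartite.

(* The Turan graph T_r(m), r > 0: its r parts are the residue classes modulo r
   in {0, ..., m-1}, whose sizes differ by at most 1 (some being empty when
   m < r). *)
Section Turan.
Variables r m : nat.

Definition turan_adj : rel 'I_m := fun x y => x %% r != y %% r.

Fact turan_sym : symmetric turan_adj.
Proof. by move=> x y; rewrite /turan_adj eq_sym. Qed.

Fact turan_irrefl : irreflexive turan_adj.
Proof. by move=> x; rewrite /turan_adj eqxx. Qed.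

Definition turan : sgraph := SGraph turan_sym turan_irrefl.

End Turan.

Section PathsAndCycles.
Variable G : sgraph.
Implicit Types p c : seq G.

(* Paths are given by their sequence of vertices, so the length (number of
   edges) of the path p is (size p).-1. *)
Definition is_path p : bool := [&& p != [::], sorted adj p & uniq p].

Definition path_edges p : {set {set G}} :=
  [set [set u.1; u.2] | u in zip p (behead p)].

(* [cycle adj] alone would accept the empty sequence and [:: x; y] for an edge
   xy. *)
Definition is_cycle c : bool := [&& 2 < size c, cycle adj c & uniq c].

Definition cycle_edges c : {set {set G}} := [set [set x; next c x] | x in c].

Definition hamiltonian_cycle c : Prop := is_cycle c /\ forall x : G, x \in c.

Definition hamiltonian_path p : Prop := is_path p /\ forall x : G, x \in p.

Definition path_in_cycle p c : Prop :=
  {subset p <= c} /\ path_edges p \subset cycle_edges c.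

End PathsAndCycles.

Definition traceable (G : sgraph) : Prop := exists p : seq G, hamiltonian_path p.

Definition path_hamiltonian (k : nat) (G : sgraph) : Prop :=
  forall p : seq G, is_path p -> (size p).-1 <= k ->
  exists2 c : seq G, hamiltonian_cycle c & path_in_cycle p c.

(* "T_r(n-1) plus a vertex v" is read, up to isomorphism, as: deleting v leaves
   T_r(n-1). *)
Definition in_J (k n r : nat) (G : sgraph) : Prop :=
  [/\ #|G| = n, clique_free r.+1 G &
   exists v : G,
     [/\ isomorphic (induced [set~ v]) (turan r n.-1),
         degree v = k.+1 &
         traceable (induced (neighbors v))]].

(* Entry (a, r, n) stands for the triple (K_a, r, n). *)
Definition exceptional_list (l : int) : seq (seq nat * nat * nat) :=
  match l with
  | Negz 0 => [:: ([:: 4; 1; 1], 4, 6); ([:: 5; 1; 1; 1], 4, 8)]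
  | Posz 0 => [:: ([:: 6; 2; 2; 1], 4, 11); ([:: 4; 1; 1; 1], 5, 7);
                  ([:: 5; 1; 1; 1; 1], 5, 9)]
  | Posz 1 => [:: ([:: 4; 1; 1; 1; 1], 6, 8); ([:: 5; 2; 1; 1; 1], 5, 10);
                  ([:: 5; 1; 1; 1; 1; 1], 6, 10)]
  | Posz 2 => [:: ([:: 6; 2; 2; 2; 1], 5, 13); ([:: 5; 2; 1; 1; 1; 1], 6, 11);
                  ([:: 5; 1; 1; 1; 1; 1; 1], 7, 11);
                  ([:: 4; 1; 1; 1; 1; 1], 7, 9)]
  | Posz 3 => [:: ([:: 5; 2; 1; 1; 1; 1; 1], 7, 12)]
  | Posz 4 => [:: ([:: 6; 2; 2; 2; 2; 1], 6, 15);
                  ([:: 5; 2; 2; 1; 1; 1; 1], 7, 13)]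
  | Posz 6 => [:: ([:: 6; 2; 2; 2; 2; 2; 1], 7, 17)]
  | _ => [::]
  end.

Definition in_hatH (l : int) (n r : nat) (G : sgraph) : Prop :=
  exists2 a : seq nat, (a, r, n) \in exceptional_list l &
    isomorphic G (complete_multipartite a).

(* The threshold on n; only meant for r >= 3. *)
Definition order_bound (r k : nat) : rat :=
  (if (r == 3)%N then 6 * k%:R + 26
   else if (r <= 7)%N then 6 * k%:R + 2 * r%:R + 3
   else k%:R + 4 * (k%:R + 4) / (r%:R - 4) + 2 * r%:R)%R.

(* Main.v *)
Require Import Defs.
From mathcomp Require Import all_boot all_order all_algebra.
From mathcomp Require Import zify ring.
From Stdlib Require Import Classical.

(** Let p be a path with at most k edges that lies on no Hamiltonian cycle.
    Adding an edge between nonadjacent vertices of degree sum at least n + k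
    creates no Hamiltonian cycle through p, since such a cycle can be rerouted
    by a crossing that avoids the edges of p. In the closure under this
    operation, a nonadjacent pair of largest degree sum yields either a vertex
    of degree at most k + 1, or some s >= 2 with 2s + k < n and s vertices of
    degree at most s + k. Deleting these vertices and applying Turan's theorem
    to the rest gives e(G) <= f(s) := e(T_r(n-s)) + s(s+k), with s = 1 in the
    first case. The hypothesis on n makes f(s) < f(1) for all s >= 2, except
    when r = 4, n = 11, k = 0, s = 5, where equality forces K_{6,2,2,1}. For
    r = 3 and s >= 3 the function f is too large, and the sharper bound comes
    from a packing of triangles: a vertex of a K_4-free graph has at most two
    neighbours in a triangle. If equality holds with s = 1, then deleting the
    low vertex v leaves T_r(n-1); the closure makes that graph complete, so a
    Hamiltonian cycle through p exists unless p runs exactly through the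
    neighbours of v (or k = 0), which makes the neighbourhood traceable. *)

Set Implicit Arguments.
Unset Strict Implicit.
Unset Printing Implicit Defensive.

(** * The size of Turan graphs *)

(** Counts the edges of the residue-class Turan graph at their larger end: among the [i] vertices
    below [i], exactly [i %/ r] lie in the class of [i]. *)
Definition turan_size (r m : nat) : nat := \sum_(i < m) (i - i %/ r).

Lemma turan_sizeS r m : turan_size r m.+1 = turan_size r m + (m - m %/ r).
Proof. by rewrite /turan_size big_ord_recr. Qed.

(** With $t = m \bmod r$ this is $e(T_r(m)) = ((r-1)m^2 - t(r-t))/(2r)$, cleared of the denominator
    and of the subtraction. *)
Lemma turan_size_closed r m : 0 < r ->
  2 * r * turan_size r m + (m %% r) * (r - m %% r) = r.-1 * m ^ 2.
Proof.
move=> r0; elim: m => [|m IH]; first by rewrite /turan_size big_ord0 mod0n !muln0.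
rewrite turan_sizeS; have Em := divn_eq m r; have lt := ltn_pmod m r0.
have ES : (m.+1 %% r = if (m %% r).+1 == r then 0 else (m %% r).+1).
  rewrite {1}Em -addnS modnMDl; case: eqP => [->|?]; first exact: modnn.
  by rewrite modn_small //; lia.
move: (turan_size r m) (m %/ r) (m %% r) (m.+1 %% r) ES Em lt IH => X q t t' -> -> lt IH.
have [d Ed] : exists d, r = t + d.+1 by exists (r - t.+1); lia.
rewrite {r r0 lt}Ed addnS in IH *; move: IH; rewrite -!mulnn /=.
have -> : (t + d).+1 - t = d.+1 by lia.
have -> : q * (t + d).+1 + t - q = q * (t + d) + t by rewrite mulnS; lia.
case: eqP => [[]|_].
  by case: d => [_|d]; rewrite ?addn0; lia.
rewrite subSS; have -> : t + d - t = d by lia.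
lia.
Qed.

Lemma turan_size_ub r m : 0 < r -> 2 * r * turan_size r m <= r.-1 * m ^ 2.
Proof. by move=> /turan_size_closed <-; rewrite leq_addr. Qed.

(** The rounding term $t(r-t)$ of the closed form is at most $r^2/4$ by the inequality between the
    means. *)
Lemma turan_size_lb r m : 0 < r ->
  4 * (r.-1 * m ^ 2) <= 8 * r * turan_size r m + r ^ 2.
Proof.
move=> r0; have := turan_size_closed m r0; have := ltn_pmod m r0.
move: (m %% r) => t lt <-.
have [d ->] : exists d, r = t + d by exists (r - t); lia.
have -> : t + d - t = d by lia.
have [h _] := nat_AGM2 t d; move: h; move: ((t + d) ^ 2) (turan_size _ _) => sq X; lia.
Qed.

(** Adding one vertex to each part adds an $r$-clique and $r-1$ edges at each old vertex. In the
    closed form the rounding term does not change, since [m + r] and [m] have the same residue. *)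
Lemma turan_size_add r m : 0 < r ->
  2 * turan_size r (m + r) = 2 * turan_size r m + 2 * r.-1 * m + r * r.-1.
Proof.
move=> r0; have := turan_size_closed m r0; have := turan_size_closed (m + r) r0.
rewrite modnDr; move: (m %% r * _) => c; case: r r0 => // r _ /=.
move: (turan_size _ _) (turan_size _ _) => X Y h1 h2.
apply/eqP; rewrite -(eqn_pmul2l (ltn0Sn r)); apply/eqP.
move: h1 h2; rewrite -!mulnn; lia.
Qed.

Lemma turan_size_mono r m : 0 < r -> turan_size r m <= turan_size r.+1 m.
Proof.
by move=> r0; apply: leq_sum => i _; apply: leq_sub2l; apply: leq_div2l.
Qed.

(** The term of index [r] is $r-1$ on the left and $r$ on the right; no other term decreases. *)
Lemma turan_size_lt r m : 0 < r -> r < m -> turan_size r m < turan_size r.+1 m.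
Proof.
move=> r0 rm; rewrite /turan_size (bigD1 (Ordinal rm)) //= [X in _ < X](bigD1 (Ordinal rm)) //=.
rewrite divnn r0 divn_small // -addSn; apply: leq_add; first by lia.
by apply: leq_sum => i _; apply: leq_sub2l; apply: leq_div2l.
Qed.

(** * Turan's theorem *)

(* [(n - q) * (n - q - 1) = d * (d + 1)] with all signs made positive. *)
Lemma square_between (q n : nat) : exists2 d : nat,
  n ^ 2 + q * q.+1 = (2 * q + 1) * n + d * d.+1 & d = 0 -> n = q \/ n = q.+1.
Proof.
rewrite -mulnn; have [h|h] := leqP n q.
  exists (q - n); last by lia.
  have -> : q = n + (q - n) by lia.
  by move: (q - n) => d; rewrite addKn; lia.
exists (n - q.+1); last by lia.
have -> : n = q.+1 + (n - q.+1) by lia.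
by move: (n - q.+1) => d; rewrite addKn; lia.
Qed.

Section DegreeSums.
Variables (V : finType) (e : rel V).
Hypotheses (e_sym : symmetric e) (e_irr : irreflexive e).
Implicit Types (A B R S : {set V}) (x y : V).

Definition deg_in A x : nat := #|[set y in A | e x y]|.
(** For a symmetric irreflexive [e] this is twice the number of edges inside [A]; keeping the factor
    2 avoids halving. *)
Definition deg_sum A : nat := \sum_(x in A) deg_in A x.

Lemma deg_inE A x : deg_in A x = \sum_(y in A) e x y.
Proof.
rewrite /deg_in -sum1_card big_mkcond [RHS]big_mkcond; apply: eq_bigr => y _.
by rewrite inE; case: (y \in A); case: (e x y).
Qed.

Lemma deg_in_le A x : deg_in A x <= #|A|.
Proof. by apply: subset_leq_card; apply/subsetP => y; rewrite inE => /andP[]. Qed.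

Lemma deg_in_setD A R x : A \subset R -> deg_in R x = deg_in A x + deg_in (R :\: A) x.
Proof.
move=> sAR; rewrite !deg_inE (bigID (mem A)) /=; congr (_ + _); apply: eq_bigl => y.
  by rewrite andbC; case: (boolP (y \in A)) => // /(subsetP sAR) ->.
by rewrite inE andbC.
Qed.

Lemma deg_inC A B : \sum_(x in A) deg_in B x = \sum_(x in B) deg_in A x.
Proof.
under eq_bigr do rewrite deg_inE.
rewrite exchange_big /=; apply: eq_bigr => y _.
by rewrite deg_inE; apply: eq_bigr => x _; rewrite e_sym.
Qed.

Lemma sum_setD A R (F : V -> nat) : A \subset R ->
  \sum_(x in R) F x = \sum_(x in A) F x + \sum_(x in R :\: A) F x.
Proof.
move=> sAR; rewrite (bigID (mem A)) /=; congr (_ + _); apply: eq_bigl => y.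
  by rewrite andbC; case: (boolP (y \in A)) => // /(subsetP sAR) ->.
by rewrite inE andbC.
Qed.

Lemma deg_sum_setD A R : A \subset R ->
  deg_sum R = deg_sum A + deg_sum (R :\: A) + 2 * \sum_(x in R :\: A) deg_in A x.
Proof.
move=> sAR; rewrite /deg_sum (sum_setD _ sAR).
under eq_bigr do rewrite (deg_in_setD _ sAR).
under [X in _ + X = _]eq_bigr do rewrite (deg_in_setD _ sAR).
by rewrite !big_split /= deg_inC; lia.
Qed.

Lemma card_setD_sub A R : A \subset R -> #|R| = #|A| + #|R :\: A|.
Proof. by move=> sAR; rewrite -(cardsID A R) (setIidPr sAR). Qed.

Definition cliqueb A : bool :=
  [forall x in A, forall y in A, (x != y) ==> e x y].

Definition has_clique R (s : nat) : bool :=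
  [exists A : {set V}, [&& A \subset R, #|A| == s & cliqueb A]].

Lemma cliqueP A : reflect {in A &, forall x y, x != y -> e x y} (cliqueb A).
Proof.
apply: (iffP forall_inP) => [h x y xA yA xy|h x xA].
  by move: (h x xA) => /forall_inP /(_ y yA) /implyP; apply.
by apply/forall_inP => y yA; apply/implyP; apply: h.
Qed.

Lemma has_cliqueP R s :
  reflect (exists A, [/\ A \subset R, #|A| = s & cliqueb A]) (has_clique R s).
Proof.
apply: (iffP existsP) => -[A].
  by move=> /and3P[? /eqP ? ?]; exists A.
by move=> [? ? ?]; exists A; apply/and3P; split => //; apply/eqP.
Qed.

Lemma has_clique_sub R R' s : R \subset R' -> has_clique R s -> has_clique R' s.
Proof.
move=> sR /has_cliqueP[A [sA cA kA]]; apply/has_cliqueP; exists A.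
by split => //; apply: subset_trans sR.
Qed.

Lemma clique_extend R A x : A \subset R -> cliqueb A -> x \in R ->
  A \subset [set y | e x y] -> has_clique R #|A|.+1.
Proof.
move=> sA /cliqueP kA xR /subsetP sN; apply/has_cliqueP; exists (x |: A).
have xA : x \notin A by apply/negP => /sN; rewrite inE e_irr.
split.
- by rewrite subUset sub1set xR.
- by rewrite cardsU1 xA.
apply/cliqueP => y z; rewrite !inE => /predU1P[->|yA] /predU1P[->|zA].
- by rewrite eqxx.
- by move=> _; move: (sN _ zA); rewrite inE.
- by move=> _; move: (sN _ yA); rewrite inE e_sym.
- exact: kA.
Qed.

Lemma deg_in_clique_le R A x : A \subset R -> cliqueb A -> x \in R ->
  ~~ has_clique R #|A|.+1 -> deg_in A x <= #|A|.-1.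
Proof.
move=> sA kA xR nC; have lt : deg_in A x < #|A|.
  rewrite ltn_neqAle deg_in_le andbT; apply/negP => /eqP E.
  move/negP: nC; apply; apply: (clique_extend sA kA xR).
  apply/subsetP => y yA; rewrite inE.
  have : y \in [set y in A | e x y].
    suff -> : [set y in A | e x y] = A by [].
    apply/eqP; rewrite eqEcard -/(deg_in A x) E leqnn andbT.
    by apply/subsetP => z; rewrite inE => /andP[].
  by rewrite inE => /andP[].
by rewrite -ltnS prednK //; lia.
Qed.

Lemma deg_sum_clique A : cliqueb A -> deg_sum A = #|A| * #|A|.-1.
Proof.
move=> /cliqueP kA; rewrite /deg_sum.
rewrite (eq_bigr (fun=> #|A|.-1)) ?sum_nat_const // => x xA.
rewrite (cardsD1 x A) xA /= /deg_in; apply: eq_card => y; rewrite !inE andbC.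
case: (eqVneq y x) => [->|yx]; first by rewrite e_irr.
by case: (boolP (y \in A)) => yA; rewrite ?andbF ?andbT //= kA // eq_sym.
Qed.

(** Induction on the clique number, then on the size of [R]. Without an $r$-clique the bound for
    $r-1$ applies. Otherwise an $r$-clique is deleted: each remaining vertex has at most $r-1$
    neighbours in it, and [turan_size_add] is exactly the resulting recursion. *)
Lemma turan_bound r R : 0 < r -> ~~ has_clique R r.+1 ->
  deg_sum R <= 2 * turan_size r #|R|.
Proof.
move=> r0; case: r r0 => // r _.
elim: r R => [|r IHr] R.
  move=> nC; rewrite /deg_sum big1 ?leq0n // => x xR.
  apply/eqP; rewrite cards_eq0; apply/eqP/setP => y; rewrite !inE.
  apply/negbTE/negP => /andP[yR xy]; move/negP: nC; apply.
  rewrite -[2]/(1.+1) -(cards1 y); apply: (@clique_extend _ _ x) => //.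
  - by rewrite sub1set.
  - by apply/cliqueP => a b /set1P -> /set1P ->; rewrite eqxx.
  - by rewrite sub1set inE.
move: {2}#|R|.+1 (ltnSn #|R|) => m; elim: m R => // m IHm R ltm nC.
have [/has_cliqueP[A [sA cA kA]]|nC'] := boolP (has_clique R r.+2); last first.
  by apply: leq_trans (IHr _ nC') _; rewrite leq_mul2l turan_size_mono.
have cR := card_setD_sub sA.
rewrite (deg_sum_setD sA) (deg_sum_clique kA) cA /=.
have h1 : deg_sum (R :\: A) <= 2 * turan_size r.+2 #|R :\: A|.
  apply: IHm; first by rewrite cR cA in ltm; lia.
  by apply: contra nC; apply: has_clique_sub; apply: subsetDl.
have h2 : \sum_(x in R :\: A) deg_in A x <= #|R :\: A| * r.+1.
  rewrite -sum_nat_const; apply: leq_sum => x; rewrite inE => /andP[_ xR].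
  by have := @deg_in_clique_le R A x sA kA xR; rewrite cA; apply.
rewrite cR cA [r.+2 + _]addnC turan_size_add //=; lia.
Qed.

(** Equality rules out the case without an $r$-clique, by [turan_size_lt], and makes every estimate
    in the deletion of such a clique tight. *)
Lemma turan_extremal_clique r R : 0 < r <= #|R| -> ~~ has_clique R r.+1 ->
  deg_sum R = 2 * turan_size r #|R| ->
  exists A, [/\ A \subset R, #|A| = r, cliqueb A &
                {in R :\: A, forall x, deg_in A x = r.-1}].
Proof.
move=> /andP[r0 rR] nC dR.
have [/has_cliqueP[A [sA cA kA]]|nC'] := boolP (has_clique R r); last first.
  case: r r0 rR nC dR nC' => // -[|r] _ rR nC dR nC'.
    have /set0Pn[x xR] : R != set0 by rewrite -card_gt0.
    case/negP: nC'; apply/has_cliqueP; exists [set x].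
    rewrite sub1set cards1; split=> //.
    by apply/cliqueP => a b /set1P -> /set1P ->; rewrite eqxx.
  have := turan_bound (ltn0Sn r) nC'.
  by have := turan_size_lt (ltn0Sn r) rR; rewrite dR; lia.
exists A; split=> // x xRA.
have cR := card_setD_sub sA.
have ub y : y \in R :\: A -> deg_in A y <= r.-1.
  rewrite inE => /andP[_ yR].
  by have := @deg_in_clique_le R A y sA kA yR; rewrite cA; apply.
have h1 : deg_sum (R :\: A) <= 2 * turan_size r #|R :\: A|.
  apply: turan_bound => //.
  by apply: contra nC; apply: has_clique_sub; apply: subsetDl.
apply/eqP; rewrite eqn_leq ub //=.
move: dR; rewrite (deg_sum_setD sA) (deg_sum_clique kA) cR cA [r + _]addnC turan_size_add //.
rewrite (big_setD1 x) //=.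
have : \sum_(y in (R :\: A) :\ x) deg_in A y <= #|(R :\: A) :\ x| * r.-1.
  by rewrite -sum_nat_const; apply: leq_sum => y /setD1P[_]; apply: ub.
rewrite (cardsD1 x (R :\: A)) xRA in h1 *; lia.
Qed.

Lemma sum_color_sq (I : finType) (A : {set I}) (c : V -> I) R :
  {in R, forall x, c x \in A} ->
  \sum_(x in R) #|[set y in R | c y == c x]| = \sum_(a in A) #|[set y in R | c y == a]| ^ 2.
Proof.
move=> cA; rewrite (partition_big c (mem A)) //=; apply: eq_bigr => a aA.
rewrite (eq_bigr (fun=> #|[set y in R | c y == a]|)); last by move=> x /andP[_ /eqP ->].
rewrite sum_nat_const -mulnn; congr (_ * _).
by apply: eq_card => x; rewrite !inE.
Qed.

Lemma sum_color (I : finType) (A : {set I}) (c : V -> I) R :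
  {in R, forall x, c x \in A} -> #|R| = \sum_(a in A) #|[set y in R | c y == a]|.
Proof.
move=> cA; rewrite -sum1_card (partition_big c (mem A)) //=; apply: eq_bigr => a aA.
by rewrite -sum1_card; apply: eq_bigl => x; rewrite !inE.
Qed.

(** A vertex is coloured by the one vertex of the clique [A] that it misses. Adjacent vertices get
    different colours, so the degree of a vertex plus the size of its class is at most [#|R|].
    Summing compares the degree sum with the squares of the class sizes, which are smallest in total
    when the sizes are balanced. *)
Lemma turan_extremal r R : 0 < r <= #|R| -> ~~ has_clique R r.+1 ->
  deg_sum R = 2 * turan_size r #|R| ->
  exists (A : {set V}) (c : V -> V),
    [/\ #|A| = r, {in R, forall x, c x \in A},
        {in R &, forall x y, e x y = (c x != c y)} &
        {in A, forall a, #|[set y in R | c y == a]| =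
            #|R| %/ r \/ #|[set y in R | c y == a]| = (#|R| %/ r).+1}].
Proof.
move=> rR nC dR; have [A [sA cA kA hA]] := turan_extremal_clique rR nC dR.
have /andP[r0 _] := rR.
have [a0 a0A] : exists a, a \in A by apply/set0Pn; rewrite -card_gt0 cA.
(* Every vertex of [R] misses exactly one vertex of the clique [A]; a vertex of
   [A] misses itself. *)
pose c x := odflt a0 [pick a in A | ~~ e x a].
have ex1 x : x \in R -> exists a, [set y in A | ~~ e x y] = [set a].
  move=> xR; apply/cards1P; apply/eqP.
  have [xA|xA] := boolP (x \in A).
    suff -> : [set y in A | ~~ e x y] = [set x] by rewrite cards1.
    apply/setP => y; rewrite !inE; case: (eqVneq y x) => [->|yx].
      by rewrite xA e_irr.
    apply/negbTE; rewrite negb_and negbK; apply/orP.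
    have [yA|] := boolP (y \in A); last by left.
    by right; apply: (cliqueP _ kA); rewrite // eq_sym.
  have := hA x; rewrite inE xA xR => /(_ isT); rewrite /deg_in.
  have := cardsID [set y | e x y] A; rewrite cA.
  have -> : A :&: [set y | e x y] = [set y in A | e x y].
    by apply/setP => y; rewrite !inE.
  have -> : A :\: [set y | e x y] = [set y in A | ~~ e x y].
    by apply/setP => y; rewrite !inE andbC.
  lia.
have cP x : x \in R -> [set y in A | ~~ e x y] = [set c x].
  move=> xR; have [a Ea] := ex1 x xR; rewrite Ea; congr [set _].
  rewrite /c; case: pickP => [b bP|/(_ a)].
    have : b \in [set a] by rewrite -Ea inE.
    by move/set1P.
  by have := set11 a; rewrite -Ea inE => ->.
have cRA x : x \in R -> c x \in A.
  by move=> xR; have := set11 (c x); rewrite -cP // inE => /andP[].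
have ce x a : x \in R -> a \in A -> a != c x -> e x a.
  move=> xR aA ax; apply/negPn/negP => nxa.
  have : a \in [set c x] by rewrite -cP // inE aA.
  by move/set1P/eqP; rewrite (negbTE ax).
have ncc x : x \in R -> ~~ e x (c x).
  by move=> xR; have := set11 (c x); rewrite -cP // inE => /andP[].
(* If adjacent [x] and [y] missed the same vertex of [A], exchanging that vertex for both of them
   would give an $(r+1)$-clique. *)
have prop x y : x \in R -> y \in R -> e x y -> c x != c y.
  move=> xR yR xy; apply/negP => /eqP cxy; move/negP: nC; apply.
  have yA : y \notin A :\ c x.
    rewrite !inE negb_and negbK; apply/orP.
    have [yA|] := boolP (y \in A); last by right.
    left; apply/eqP; apply/set1P; rewrite cxy -cP // inE yA e_irr //.
  have sub : y |: (A :\ c x) \subset R.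
    by rewrite subUset sub1set yR (subset_trans _ sA) // subsetDl.
  have clq : cliqueb (y |: (A :\ c x)).
    apply/cliqueP => a b; rewrite !inE.
    move=> /predU1P[->|/andP[aN aA]] /predU1P[->|/andP[bN bA]].
    - by rewrite eqxx.
    - by move=> _; apply: ce => //; rewrite -cxy.
    - by move=> _; rewrite e_sym; apply: ce => //; rewrite -cxy.
    - exact: (cliqueP _ kA).
  have := @clique_extend R (y |: (A :\ c x)) x sub clq xR.
  rewrite cardsU1 yA -cA (cardsD1 (c x) A) cRA //; apply.
  apply/subsetP => z; rewrite !inE => /predU1P[->//|/andP[zN zA]].
  exact: ce.
have degle x : x \in R -> deg_in R x + #|[set y in R | c y == c x]| <= #|R|.
  move=> xR; rewrite /deg_in -(cardsID [set y | e x y] R).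
  apply: leq_add; apply: subset_leq_card; apply/subsetP => y; rewrite !inE //.
  move=> /andP[yR cyx]; rewrite yR andbT; apply/negP => /(prop _ _ xR yR).
  by rewrite eq_sym cyx.
pose q := #|R| %/ r; pose n a := #|[set y in R | c y == a]|.
have Rq := divn_eq #|R| r.
have szR := @sum_color _ A c R cRA.
have clo := turan_size_closed #|R| r0.
have sq a : (2 * q + 1) * n a <= n a ^ 2 + q * q.+1.
  by have [d -> _] := square_between q (n a); rewrite leq_addr.
have tot : deg_sum R + \sum_(a in A) n a ^ 2 <= #|R| ^ 2.
  rewrite -(sum_color_sq cRA) /deg_sum -big_split /=.
  by rewrite -mulnn -sum_nat_const; apply: leq_sum => x xR; apply: degle.
have sumsq : (2 * q + 1) * #|R| <= \sum_(a in A) n a ^ 2 + r * (q * q.+1).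
  rewrite [X in _ * X]szR big_distrr /= -cA -sum_nat_const -big_split /=.
  by apply: leq_sum => a _; apply: sq.
(* Since [deg_sum R] is twice the Turan number, this identity turns [tot] and [sumsq] into
   equalities. A nonadjacent pair of different colours would make [tot] strict; a class of size
   other than [q] and [q.+1] would make [sumsq] strict. *)
have key : 2 * turan_size r #|R| + (2 * q + 1) * #|R| = #|R| ^ 2 + r * (q * q.+1).
  have lt := ltn_pmod #|R| r0.
  apply/eqP; rewrite -(eqn_pmul2l r0); apply/eqP.
  move: Rq lt clo; rewrite /q; clear -r0.
  move: #|R| (#|R| %% r) (#|R| %/ r) (turan_size _ _) => m t q X.
  move=> Em lt; have [d Ed] : exists d, r = t + d.+1 by exists (r - t.+1); lia.
  move: Em; rewrite Ed; have -> : t + d.+1 - t = d.+1 by lia.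
  have -> : (t + d.+1).-1 = t + d by lia.
  by move=> -> ; rewrite -!mulnn; lia.
exists A, c; split=> //.
  move=> x y xR yR; apply/idP/idP; first exact: prop.
  move=> cxy; apply/negPn/negP => nxy.
  have : deg_sum R + \sum_(a in A) n a ^ 2 < #|R| ^ 2.
    rewrite -(sum_color_sq cRA) /deg_sum -big_split /= (big_setD1 x) //=.
    have lt : deg_in R x + #|[set y in R | c y == c x]| < #|R|.
      rewrite /deg_in -(cardsID [set y | e x y] R) -addnS.
      apply: leq_add; first by apply: subset_leq_card; apply/subsetP => z; rewrite !inE.
      apply: proper_card; apply/properP; split.
        apply/subsetP => z; rewrite !inE.
        move=> /andP[zR czx]; rewrite zR andbT; apply/negP => /(prop _ _ xR zR).
        by rewrite eq_sym czx.
      by exists y; rewrite !inE yR ?nxy //= eq_sym (negbTE cxy).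
    have : \sum_(z in R :\ x) (deg_in R z + #|[set y in R | c y == c z]|) <= #|R :\ x| * #|R|.
      rewrite -sum_nat_const; apply: leq_sum => z /setD1P[_]; exact: degle.
    have cRx : #|R| = (#|R :\ x|).+1 by rewrite (cardsD1 x R) xR.
    move: lt; rewrite cRx -mulnn; clear; lia.
  lia.
move=> a aA; rewrite -/(n a) -/q.
have : (2 * q + 1) * n a = n a ^ 2 + q * q.+1.
  apply/eqP; rewrite eqn_leq sq /= leqNgt; apply/negP => lt.
  suff : (2 * q + 1) * #|R| < \sum_(a in A) n a ^ 2 + r * (q * q.+1) by lia.
  rewrite [X in _ * X]szR big_distrr /= -cA -sum_nat_const -big_split /=.
  rewrite (big_setD1 a) //= [X in _ < X](big_setD1 a) //= -addSn; apply: leq_add => //.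
  by apply: leq_sum => b _; apply: sq.
by have [[|d] -> h] := square_between q (n a); [move=> _; apply: h|lia].
Qed.

(* Removing a triangle from [R] changes the right-hand side by exactly the
   largest amount by which the left-hand side can change. *)
Lemma triangle_packing_bound (S R : {set V}) :
  (forall A x, A \subset R -> x \in R :|: S -> #|A| = 3 -> cliqueb A -> deg_in A x <= 2) ->
  6 * (deg_sum R + \sum_(x in R) deg_in S x) <= (2 * #|R| + #|S|) ^ 2.
Proof.
move: {2}#|R|.+1 (ltnSn #|R|) => m; elim: m R => // m IHm R ltm hA.
have [/has_cliqueP[A [sA cA kA]]|nC'] := boolP (has_clique R 3); last first.
  (* With $m = |R|$ and $s = |S|$, Mantel's theorem bounds the left-hand side by $3m^2 + 6ms$, which
     is $(2m+s)^2 - (m-s)^2$. *)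
  have h1 := turan_bound (isT : 0 < 2) nC'.
  have h2 := turan_size_ub #|R| (isT : 0 < 2).
  have : \sum_(x in R) deg_in S x <= #|R| * #|S|.
    by rewrite -sum_nat_const; apply: leq_sum => x _; apply: deg_in_le.
  have [+ _] := nat_AGM2 #|R| #|S|.
  move: h1 h2; rewrite mul1n -!mulnn; clear.
  by move: #|R| #|S| (turan_size _ _) (deg_sum _) (\sum_(x in R) _); lia.
have cR := card_setD_sub sA.
rewrite (deg_sum_setD sA) (deg_sum_clique kA) cA (sum_setD _ sA) /= (deg_inC A S).
have h1 : 6 * (deg_sum (R :\: A) + \sum_(x in R :\: A) deg_in S x) <=
    (2 * #|R :\: A| + #|S|) ^ 2.
  apply: IHm; first by rewrite cR cA in ltm; lia.
  move=> B x sB xR cB kB; apply: hA => //; first exact: subset_trans sB (subsetDl _ _).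
  by move: xR; rewrite !inE => /orP[/andP[_ ->]|->]; rewrite ?orbT.
have h2 : \sum_(x in R :\: A) deg_in A x <= #|R :\: A| * 2.
  rewrite -sum_nat_const; apply: leq_sum => x; rewrite inE => /andP[_ xR].
  by apply: hA => //; rewrite inE xR.
have h3 : \sum_(x in S) deg_in A x <= #|S| * 2.
  rewrite -sum_nat_const; apply: leq_sum => x xS.
  by apply: hA => //; rewrite inE xS orbT.
move: h1 h2 h3; rewrite cR cA; move: (\sum_(x in S) _) (\sum_(x in _) _) (\sum_(x in _) _).
rewrite -!mulnn; lia.
Qed.

End DegreeSums.

(** * Hamiltonian cycles through a prescribed path *)

Section PathEdges.
Variable V : finType.
Implicit Types (e : rel V) (F : {set {set V}}) (c p q s t : seq V) (u v w x y : V).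

(** [pedges] and [cedges] repeat [path_edges] and [cycle_edges] over a bare finite type, because the
    closure changes the adjacency relation while the vertices stay. *)
Definition pedges p : {set {set V}} := [set [set z.1; z.2] | z in zip p (behead p)].
Definition cedges c : {set {set V}} := [set [set x; next c x] | x in c].

Lemma pedges1 x : pedges [:: x] = set0.
Proof. by apply/setP => E; rewrite inE; apply/imsetP => -[]. Qed.

Lemma pedges_cons2 x y s : pedges (x :: y :: s) = [set x; y] |: pedges (y :: s).
Proof.
apply/setP => E; rewrite in_setU1; apply/imsetP/predU1P.
  move=> [z]; rewrite /= inE => /predU1P[->|zs] -> ; first by left.
  by right; apply/imsetP; exists z.
move=> [->|/imsetP[z zs ->]]; first by exists (x, y); rewrite //= inE eqxx.
by exists z; rewrite //= inE zs orbT.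
Qed.

Lemma pedges_cat x s y t :
  pedges ((x :: s) ++ y :: t) =
  pedges (x :: s) :|: ([set last x s; y] |: pedges (y :: t)).
Proof.
elim: s x => [|a s IH] x /=; first by rewrite pedges_cons2 pedges1 set0U.
by rewrite pedges_cons2 IH pedges_cons2 -!setUA.
Qed.

Lemma pedges_rcons2 s y x : pedges (rcons (rcons s y) x) = [set y; x] |: pedges (rcons s y).
Proof.
case: s => [|a s] /=; first by rewrite pedges_cons2.
rewrite -cats1 -cat_cons pedges_cat last_rcons pedges1 setU0 setUC //.
Qed.

Lemma pedges_rev s : pedges (rev s) = pedges s.
Proof.
elim: s => // x [|y s] IH //.
by rewrite rev_cons rev_cons pedges_rcons2 -rev_cons IH pedges_cons2 setUC [[set y; x]]setUC setUC.
Qed.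

Lemma pedges_nth x s E :
  reflect (exists2 i, i < size s & E = [set nth x (x :: s) i; nth x s i])
          (E \in pedges (x :: s)).
Proof.
have sz : size (zip (x :: s) s) = size s by rewrite size_zip /=; lia.
have nz i : i < size s -> nth (x, x) (zip (x :: s) s) i = (nth x (x :: s) i, nth x s i).
  by move=> lt; rewrite nth_zip_cond sz lt.
apply: (iffP imsetP).
  move=> [z /= /(nthP (x, x))[i]]; rewrite sz => lt <- ->.
  by exists i => //; rewrite nz.
move=> [i lt ->]; exists (nth (x, x) (zip (x :: s) s) i); last by rewrite nz.
by rewrite mem_nth // sz.
Qed.

Lemma cedgesE x s : uniq (x :: s) -> cedges (x :: s) = [set last x s; x] |: pedges (x :: s).
Proof.
move=> un.
have nx i : i <= size s -> next (x :: s) (nth x (x :: s) i) = nth x s i.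
  by move=> le; rewrite next_nth mem_nth // index_uniq.
apply/setP => E; rewrite in_setU1; apply/imsetP/predU1P.
  move=> [y /(nthP x)[i]]; rewrite [size _]/= ltnS => le <- ->; rewrite nx //.
  have [lt|ge] := ltnP i (size s); first by right; apply/pedges_nth; exists i.
  left; have -> : i = size s by lia.
  by rewrite [nth x s _]nth_default // (last_nth x).
have lx : next (x :: s) (last x s) = x.
  by have := nx (size s) (leqnn _); rewrite -last_nth [nth x s _]nth_default.
move=> [->|/pedges_nth[i lt ->]].
  by exists (last x s); rewrite ?mem_last ?lx.
by exists (nth x (x :: s) i); rewrite ?nx ?mem_nth //= ltnW.
Qed.

Lemma cedges_rot i c : uniq c -> cedges (rot i c) = cedges c.
Proof.
move=> un; apply/setP => E; apply/imsetP/imsetP => -[x xc ->]; exists x.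
- by rewrite mem_rot in xc.
- by rewrite next_rot.
- by rewrite mem_rot.
- by rewrite next_rot.
Qed.

Definition spanning_cycle e F := exists c,
  [/\ 2 < size c, cycle e c, uniq c, forall x, x \in c & F \subset cedges c].

Definition deg e x := #|[set y | e x y]|.

Lemma size_full c : uniq c -> (forall x, x \in c) -> size c = #|V|.
Proof. by move=> /card_uniqP <- h; apply: eq_card => x; rewrite h inE. Qed.

Lemma count_full (a : pred V) c : uniq c -> (forall x, x \in c) ->
  count a c = #|[set y | a y]|.
Proof.
move=> un h; rewrite -size_filter -(card_uniqP (filter_uniq a un)).
by apply: eq_card => x; rewrite mem_filter inE h andbT.
Qed.

Lemma zip_belast x s : zip (x :: s) s = zip (belast x s) s.
Proof. by elim: s x => //= y s IH x; rewrite -IH. Qed.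

(** The head occurs in no later pair. Distinctness of the pairs is what bounds the number of path
    positions with an edge in [F] by [#|F|]. *)
Lemma uniq_consecutive x s :
  uniq (x :: s) -> uniq [seq [set z.1; z.2] | z <- zip (x :: s) s].
Proof.
elim: s x => //= y s IH x /andP[xN un]; rewrite IH // andbT.
apply/mapP => -[[a b] ab /= Exy].
have : x \in [set a; b] by rewrite -Exy set21.
have as_ : a \in y :: s.
  apply: mem_belast; rewrite -(@unzip1_zip _ _ (belast y s) s) ?size_belast //.
  by rewrite -zip_belast; apply: (map_f fst ab).
have bs : b \in y :: s.
  rewrite inE -[X in _ || (_ \in X)](@unzip2_zip _ _ (belast y s) s) ?size_belast //.
  by rewrite -zip_belast (map_f snd ab) orbT.
by case/set2P => E; move: xN; rewrite E ?as_ ?bs.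
Qed.

Lemma mem_consecutive x s z : z \in zip (x :: s) s ->
  exists s1 s2, x :: s = rcons s1 z.1 ++ z.2 :: s2.
Proof.
elim: s x => //= y s IH x; rewrite inE => /predU1P[->|/IH[s1 [s2 E]]].
  by exists [::], s.
by exists (x :: s1), s2; rewrite E.
Qed.

(** Pigeonhole: [a] and [b] hold together at no fewer than [count a Z + count b Z - size Z]
    positions, more than [d] can spoil. *)
Lemma has_crossing (T : eqType) (Z : seq T) (a b d : pred T) :
  size Z + count d Z < count a Z + count b Z ->
  exists2 z, z \in Z & [&& a z, b z & ~~ d z].
Proof.
move=> lt; apply/hasP; rewrite has_count; move: lt.
elim: Z => //= z Z IH; case: (a z); case: (b z); case: (d z) => /=; lia.
Qed.

(** Ore's crossing argument. Of the $n-1$ path edges $xy$, with $x$ before $y$, at least $k+1$ have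
    $u$ adjacent to $y$ and $x$ adjacent to the last vertex $w$. At most $k$ edges lie in [F], so
    some crossing spares [F]. *)
Lemma close_path e F k u s : symmetric e -> irreflexive e ->
  2 < #|V| -> uniq (u :: s) -> (forall x, x \in u :: s) -> path e u s ->
  F \subset pedges (u :: s) -> #|F| <= k ->
  #|V| + k <= deg e u + deg e (last u s) -> spanning_cycle e F.
Proof.
move=> sym irr n3 un full pth sF cF ge; set w := last u s in ge *.
have sz := size_full un full; rewrite /= in sz.
pose Z := zip (u :: s) s.
have cu : count (fun z => e u z.2) Z = deg e u.
  rewrite /deg -(count_full (e u) un full) /= irr add0n.
  rewrite -[X in _ = count _ X](@unzip2_zip _ _ (belast u s)) ?size_belast //.
  by rewrite -zip_belast count_map.
have cw : count (fun z => e w z.1) Z = deg e w.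
  rewrite /deg -(count_full (e w) un full) lastI -cats1 count_cat /= irr !addn0.
  rewrite -[X in _ = count _ X](@unzip1_zip _ _ _ s) ?size_belast //.
  by rewrite -zip_belast count_map.
have cd : count (fun z => [set z.1; z.2] \in F) Z <= k.
  apply: leq_trans cF.
  have -> : count (fun z => [set z.1; z.2] \in F) Z = count (mem F) [seq [set z.1; z.2] | z <- Z].
    by rewrite count_map.
  rewrite -size_filter.
  have /card_uniqP <- := filter_uniq (mem F) (uniq_consecutive un).
  by apply: subset_leq_card; apply/subsetP => E; rewrite mem_filter => /andP[].
have sZ : size Z = size s by rewrite size_zip /=; lia.
have [z zZ /and3P[a b d]] : exists2 z, z \in Z &
    [&& e u z.2, e w z.1 & [set z.1; z.2] \notin F].
  apply: (@has_crossing _ Z (fun z => e u z.2) (fun z => e w z.1)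
    (fun z => [set z.1; z.2] \in F)); rewrite cu cw sZ.
  by rewrite -sz in ge; apply: leq_trans ge; rewrite addSn ltnS leq_add2l.
have [s1 [s2 Es]] := mem_consecutive zZ; move: z a b d {zZ} Es => [x y] /= a b d Es.
have [t Et] : exists t, rcons s1 x = u :: t.
  by case: s1 Es => [|u' s1] [-> _]; [exists [::]|exists (rcons s1 x)].
have lt : last u t = x by rewrite -(last_cons u) -Et last_rcons.
have Es' : s = t ++ y :: s2 by move: Es; rewrite Et => -[].
have wE : w = last y s2 by rewrite /w Es' last_cat /=.
have rE : rev (y :: s2) = w :: rev (belast y s2) by rewrite lastI rev_rcons wE.
(* The path $u \dots x\,y \dots w$ becomes the cycle $u \dots x\,w \dots y$: the edge $xy$ is
   replaced by $xw$ and $yu$. *)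
pose c := (u :: t) ++ rev (y :: s2).
have prm : perm_eq c (u :: s) by rewrite /c Es' -cat_cons perm_cat2l perm_rev.
have unc : uniq c by rewrite (perm_uniq prm).
exists c; split=> //.
- by rewrite (perm_size prm) /= sz.
- move: pth; rewrite Es' cat_path /= => /and3P[pt _ ps2].
  rewrite /c rE rcons_cat cat_path pt lt /= sym b /= rcons_path.
  have := ps2; rewrite -(eq_path (e := fun a b => e b a)); last by move=> ? ?; rewrite sym.
  rewrite -rev_path -wE => -> /=.
  have -> : last w (rev (belast y s2)) = y.
    by rewrite -(last_cons w) -rE rev_cons last_rcons.
  by rewrite sym.
- by move=> x'; rewrite (perm_mem prm).
move: unc; rewrite /c; move=> unc; rewrite cat_cons cedgesE // -cat_cons rE pedges_cat -rE.
rewrite pedges_rev; apply/subsetP => E EF; move/subsetP/(_ _ EF): sF.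
rewrite Es' -cat_cons pedges_cat !inE lt => /or3P[->|/eqP E'|->]; rewrite ?orbT //.
by move: d; rewrite -E' EF.
Qed.

Definition add_edge e u w : rel V :=
  fun x y => [|| e x y, (x == u) && (y == w) | (x == w) && (y == u)].

Lemma add_edgeC e u w : add_edge e u w =2 add_edge e w u.
Proof. by move=> x y; rewrite /add_edge; congr orb; rewrite orbC. Qed.

Lemma add_edge_sym e u w : symmetric e -> symmetric (add_edge e u w).
Proof.
by move=> sym x y; rewrite /add_edge sym; congr orb; rewrite orbC ![(y == _) && _]andbC.
Qed.


End PathEdges.

(** * The Bondy-Chvatal closure relative to a set of protected edges *)

Section Closure.
Variable V : finType.
Implicit Types (e : rel V) (F : {set {set V}}) (c p q s t : seq V) (u v w x y : V).

Lemma next_neq c x : uniq c -> 1 < size c -> x \in c -> next c x != x.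
Proof.
move=> un sz xc; have [i s E] := rot_to xc.
rewrite -(next_rot i un) E; have := un; rewrite -(rot_uniq i) E.
have : 1 < size (x :: s) by rewrite -E size_rot.
case: s {E} => //= y s _ /andP[]; rewrite inE negb_or eqxx => /andP[xy _] _.
by rewrite eq_sym.
Qed.

Lemma complete_cycle e c : (forall x y, x != y -> e x y) -> uniq c -> 1 < size c -> cycle e c.
Proof.
move=> h un sz; apply: cycle_from_next => // x xc; apply: h.
by rewrite eq_sym next_neq.
Qed.

(** The new edge could be used only when leaving [u], which occurs at the head alone, and its other
    end comes last, hence not second unless the path is a single edge. *)
Lemma add_edge_path e u s : u != last u s -> s != [:: last u s] -> uniq (u :: s) ->
  path (add_edge e u (last u s)) u s -> path e u s.
Proof.
case: s => // y s uw sN un.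
have yw : y != last u (y :: s).
  apply: contra sN => /eqP; move: un => /= /and3P[_ + _]; clear.
  by case: s => //= a s yN E; move: yN; rewrite E mem_last.
move: un uw yw; rewrite cons_uniq => /andP[uN _] uw yw.
have [w Ew] : exists w, w = last u (y :: s) by eexists.
rewrite -Ew in uw yw *; rewrite /= => /andP[uy ps].
have uy' : e u y.
  by move: uy; rewrite /add_edge eqxx (negbTE yw) (negbTE uw) /= orbF.
rewrite uy' /=.
apply: (@sub_in_path _ (mem (y :: s)) (add_edge e u w)) ps; last by apply/allP.
move=> a b aS bS; rewrite /add_edge => /or3P[//|/andP[/eqP au _]|/andP[_ /eqP bu]].
  by move: uN; rewrite -au aS.
by move: uN; rewrite -bu bS.
Qed.

(** If the cycle uses the new edge, cutting it there leaves a spanning path from [u] to [w] that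
    still carries [F], as [F] avoids this edge; [close_path] then applies. *)
Lemma spanning_cycle_add_edge e F k u w : symmetric e -> irreflexive e ->
  2 < #|V| -> u != w -> [set u; w] \notin F -> #|F| <= k ->
  #|V| + k <= deg e u + deg e w ->
  spanning_cycle (add_edge e u w) F -> spanning_cycle e F.
Proof.
move=> sym irr n3 uw uwF cF ge [c [sz cy un full sF]].
have [/allP al|] := boolP (all (fun x => e x (next c x)) c).
  by exists c; split=> //; apply: cycle_from_next.
move=> /allPn[x xc nex].
wlog [xw nxu] : u w uw uwF ge cy / x = w /\ next c x = u.
  move=> H; have := next_cycle cy xc.
  rewrite /add_edge (negbTE nex) /= => /orP[] /andP[/eqP xu /eqP nxw].
    apply: (H w u) => //; first by rewrite eq_sym.
    - by rewrite setUC.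
    - by rewrite [X in _ <= X]addnC.
    - by rewrite (eq_cycle (add_edgeC e w u)).
  exact: (H u w).
have [i s E] := rot_to (full u).
have un' : uniq (u :: s) by rewrite -E rot_uniq.
have full' y : y \in u :: s by rewrite -E mem_rot.
have ls : last u s = w.
  have wc : w \in u :: s by [].
  apply/eqP; move: (mem_last u s) => lm.
  have nw : next (u :: s) w = u by rewrite -E next_rot // -xw.
  have nl : next (u :: s) (last u s) = u.
    have : cycle (fun a b => b == next (u :: s) a) (u :: s).
      by apply: cycle_from_next.
    by rewrite {1}/cycle rcons_path => /andP[_ /eqP].
  by rewrite -(inj_eq (can_inj (prev_next un'))) nl nw.
have sz' : 2 < size (u :: s) by rewrite -E size_rot.
have pth : path e u s.
  apply: add_edge_path; rewrite ?ls //.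
    by apply/eqP => Es; move: sz'; rewrite Es.
  move: cy; rewrite -(rot_cycle i) E /= rcons_path => /andP[+ _].
  by [].
apply: (@close_path _ e F k u s) => //; last by rewrite ls.
rewrite -(cedges_rot i un) E cedgesE // ls in sF.
apply/subsetP => X XF; move/subsetP/(_ _ XF): sF; rewrite in_setU1 => /orP[/eqP XE|//].
by move: uwF; rewrite setUC -XE XF.
Qed.

(** Induction on the number of nonadjacent ordered pairs. Edges of [F] are present from the start,
    so an added edge is never one of them. *)
Lemma closure_exists n e F k : #|V| = n -> symmetric e -> irreflexive e -> 2 < n -> #|F| <= k ->
  (forall u w, u != w -> [set u; w] \in F -> e u w) ->
  exists e', [/\ symmetric e', irreflexive e', subrel e e',
    spanning_cycle e' F -> spanning_cycle e F &
    forall u w, u != w -> ~~ e' u w -> deg e' u + deg e' w < n + k].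
Proof.
move=> cV + + n3 cF; move: {2}(#|_|.+1) (ltnSn #|[set z : V * V | ~~ e z.1 z.2]|) => m.
elim: m e => // m IH e ltm sym irr eF.
have [/forallP h|] := boolP [forall u, forall w,
    (u != w) && ~~ e u w ==> (deg e u + deg e w < n + k)].
  exists e; split=> // u w uw euw.
  by move: (h u) => /forallP/(_ w)/implyP; apply; rewrite uw.
rewrite negb_forall => /existsP[u]; rewrite negb_forall => /existsP[w].
rewrite negb_imply -leqNgt => /andP[/andP[uw euw] ge].
have sub : subrel e (add_edge e u w) by move=> x y; rewrite /add_edge => ->.
have [||||e' [s1 i1 sb cl dg]] := IH (add_edge e u w).
- rewrite -ltnS; apply: leq_trans ltm; rewrite ltnS; apply: proper_card; apply/properP; split.
    by apply/subsetP => z; rewrite !inE; apply: contra; apply: sub.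
  by exists (u, w); rewrite !inE // /add_edge /= !eqxx orbT.
- exact: add_edge_sym.
- move=> x; rewrite /add_edge irr /=; apply/negP => /orP[] /andP[/eqP xa /eqP xb];
  by move: uw; rewrite -xa -xb eqxx.
- by move=> a b ab /(eF _ _ ab); apply: sub.
exists e'; split=> //; first by move=> x y /sub /sb.
move=> /cl; apply: (@spanning_cycle_add_edge _ _ k) => //; rewrite ?cV //.
by apply/negP => /(eF _ _ uw); rewrite (negbTE euw).
Qed.

Lemma deg_mono e e' x : subrel e e' -> deg e x <= deg e' x.
Proof. by move=> sb; apply: subset_leq_card; apply/subsetP => y; rewrite !inE; apply: sb. Qed.

Lemma card_pedges p : #|pedges p| <= (size p).-1.
Proof.
apply: leq_trans (leq_imset_card _ _) _; apply: leq_trans (card_size _) _.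
by rewrite size_zip size_behead; lia.
Qed.

Lemma pedges_adj e p u w : symmetric e -> sorted e p -> [set u; w] \in pedges p ->
  u != w -> e u w.
Proof.
move=> sym; case: p => [|x s]; first by move=> _ /imsetP[].
elim: s x => [|y s IH] x; first by rewrite pedges1 inE.
rewrite pedges_cons2 in_setU1 => /= /andP[xy ps] /predU1P[E uw|]; last exact: IH.
have : u \in [set x; y] by rewrite -E set21.
have : w \in [set x; y] by rewrite -E set22.
move=> /set2P[] Ew /set2P[] Eu; move: uw; rewrite Ew Eu ?eqxx //.
by rewrite sym.
Qed.

Lemma spanning_cycle_complete e p : p != [::] -> (forall x y, x != y -> e x y) ->
  2 < #|V| -> uniq p -> spanning_cycle e (pedges p).
Proof.
move=> p0 h n3 un; pose r := [seq x <- enum V | x \notin p].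
have unc : uniq (p ++ r).
  rewrite cat_uniq un filter_uniq ?enum_uniq // andbT.
  by apply/hasPn => x; rewrite mem_filter => /andP[].
have full x : x \in p ++ r by rewrite mem_cat mem_filter mem_enum andbT orbN.
have sz := size_full unc full.
exists (p ++ r); split=> //; first by rewrite sz.
  by apply: complete_cycle; rewrite // sz ltnW.
clearbody r; clear full sz; move: unc; case: p p0 un => // x s _ _ unc.
rewrite cat_cons cedgesE // subsetU // -cat_cons.
apply/orP; right; case: r {unc} => [|y r]; first by rewrite cats0.
by rewrite pedges_cat subsetUl.
Qed.

(* In the closure take nonadjacent [u], [w] of largest degree sum, with
   [deg u <= deg w]: the non-neighbours of [w] have degree at most [deg u], those
   of [u] at most [deg w]; [s] is [deg u - k]. *)
Lemma no_cycle_degrees n e p k : #|V| = n -> symmetric e -> irreflexive e -> 2 < n ->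
  p != [::] -> sorted e p -> uniq p -> (size p).-1 <= k ->
  ~ spanning_cycle e (pedges p) ->
  (exists v, deg e v <= k.+1) \/
  exists s : nat, [/\ 2 <= s, 2 * s + k < n, s <= #|[set x | deg e x <= s + k]| &
                n - k - s <= #|[set x | deg e x <= n.-1 - s]|].
Proof.
move=> cV sym irr n3 p0 sp up szp nC.
have [|e' [sym' irr' sb cl dg]] := closure_exists cV sym irr n3 (leq_trans (card_pedges p) szp).
  by move=> u w uw E; apply: (pedges_adj sym sp E).
have nC' : ~ spanning_cycle e' (pedges p) by move/cl.
pose P := fun z : V * V => (z.1 != z.2) && ~~ e' z.1 z.2.
have [z0 Pz0] : exists z, P z.
  case: (pickP P) => [z Pz|h]; first by exists z.
  case: nC'; apply: spanning_cycle_complete; rewrite ?cV // => x y xy.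
  by have := h (x, y); rewrite /P /= xy /= => /negbFE.
pose f z := deg e' z.1 + deg e' z.2.
have [z Pz zmax] := @arg_maxnP _ z0 P f Pz0.
wlog le : z Pz zmax / deg e' z.1 <= deg e' z.2.
  move=> H; have [|/ltnW le] := leqP (deg e' z.1) (deg e' z.2); first exact: (H z).
  apply: (H (z.2, z.1)) => //.
    by move: Pz; rewrite /P /= eq_sym sym'.
  by move=> t /zmax; rewrite /f addnC.
case: z Pz zmax le => u w /= /andP[/= uw euw] zmax le.
have sum : deg e' u + deg e' w < n + k := dg u w uw euw.
set h := deg e' u in le sum *; set g := deg e' w in le sum *.
have compl x : #|[set y | ~~ e' x y]| + deg e' x = n.
  by rewrite -cV -(cardsC [set y | e' x y]) addnC; congr (_ + #|pred_of_set _|); apply/setP => y; rewrite !inE.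
have [hk|hk] := leqP h k.+1.
  by left; exists u; apply: leq_trans hk; apply: deg_mono.
have gn : g < n.
  have := compl w; have : 0 < #|[set y | ~~ e' w y]|.
    by apply/card_gt0P; exists w; rewrite inE irr'.
  by rewrite -/g; lia.
(* The bound $h + g \le n + k - 1$ gives all four claims: $2h \le h + g$ yields $2s + k < n$; [w]
   has $n-1-g \ge s$ non-neighbours besides itself; [u] has $n-h$ non-neighbours counting itself, of
   degree at most $g \le n-1-s$. *)
right; exists (h - k); split; [lia|lia| |].
- apply: (@leq_trans #|[set y | ~~ e' w y] :\ w|).
    have := compl w; rewrite (cardsD1 w) inE irr' /= -/g; lia.
  apply: subset_leq_card; apply/subsetP => x; rewrite !inE => /andP[xw ewx].
  have := zmax (x, w); rewrite /P /f /= xw sym' ewx => /(_ isT).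
  rewrite -/h -/g leq_add2r => hx; apply: leq_trans (deg_mono x sb) _.
  by rewrite subnK //; lia.
apply: (@leq_trans #|[set y | ~~ e' u y]|).
  have := compl u; rewrite -/h; lia.
apply: subset_leq_card; apply/subsetP => x; rewrite !inE => eux.
apply: leq_trans (deg_mono x sb) _.
have [->|xu] := eqVneq x u; first by rewrite -/h; lia.
have := zmax (u, x); rewrite /P /f /= eq_sym xu eux => /(_ isT).
by rewrite -/h -/g leq_add2l => hx; lia.
Qed.

Lemma complete_path e x s : {in x :: s &, forall a b, a != b -> e a b} ->
  uniq (x :: s) -> path e x s.
Proof.
elim: s x => //= y s IH x h /and3P[xN yN un].
rewrite h ?inE ?eqxx ?orbT //=; last by move: xN; rewrite inE negb_or => /andP[].
apply: IH; last by rewrite /= yN.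
by move=> a b aS bS; apply: h; rewrite inE ?aS ?bS orbT.
Qed.

Lemma spanning_cycle_through e v a q1 q2 b : 2 < #|V| ->
  (forall x y, x != v -> y != v -> x != y -> e x y) ->
  uniq (v :: (a :: q1) ++ rcons q2 b) -> e v a -> e b v ->
  spanning_cycle e ([set v; a] |: (pedges (a :: q1) :|: ([set b; v] |: pedges (rcons q2 b)))).
Proof.
move=> n3 h un va bv.
pose r := [seq x <- enum V | x \notin v :: (a :: q1) ++ rcons q2 b].
pose s := (a :: q1) ++ (r ++ rcons q2 b).
have prm : perm_eq (v :: s) (r ++ (v :: (a :: q1) ++ rcons q2 b)).
  by rewrite -[v :: s]/((v :: a :: q1) ++ r ++ rcons q2 b) perm_catCA.
have unc : uniq (v :: s).
  rewrite (perm_uniq prm) cat_uniq un filter_uniq ?enum_uniq // andbT.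
  by apply/hasPn => x xp; rewrite mem_filter xp.
have full x : x \in v :: s.
  by rewrite (perm_mem prm) mem_cat mem_filter mem_enum andbT orNb.
have sz := size_full unc full.
have ls : last v s = b by rewrite /s !last_cat last_rcons.
exists (v :: s); split=> //; first by rewrite sz.
  rewrite -[cycle _ _]/(path e v (rcons s v)) rcons_path ls bv andbT /= va /=.
  have un2 : uniq s by move: unc => /= /andP[].
  apply: complete_path => // x y xs ys; apply: h.
    by apply/eqP => E; move: unc; rewrite /= -E xs.
  by apply/eqP => E; move: unc; rewrite /= -E ys.
rewrite cedgesE // ls /s pedges_cons2.
have pr : pedges (a :: q1) :|: pedges (rcons q2 b) \subset pedges ((a :: q1) ++ (r ++ rcons q2 b)).
  have [y [t E]] : exists y t, rcons q2 b = y :: t.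
    by case: (q2) => [|y t]; [exists b, [::]|exists y, (rcons t b)].
  rewrite E; case: (r) => [|z r']; rewrite [_ ++ y :: t]/=.
    by rewrite pedges_cat setUS // subsetUr.
  rewrite pedges_cat setUS // -cat_cons pedges_cat.
  by apply/subsetP => E' h'; rewrite !inE h' !orbT.
apply/subsetP => E; rewrite !inE.
have := subsetP pr E; rewrite !inE => prE.
move=> /or4P[->|h1|->|h2]; rewrite ?orbT //.
- by rewrite prE ?h1 ?orbT.
- by rewrite prE ?h2 ?orbT.
Qed.

End Closure.

(** * A vertex of degree $k+1$ whose removal leaves a graph with complete closure *)

Section LowVertex.
Variable V : finType.
Implicit Types (e : rel V) (p q : seq V) (a b v x y : V).

Lemma pedges_cat_rcons p b q v :
  pedges (rcons p b ++ v :: q) = pedges (rcons p b) :|: ([set b; v] |: pedges (v :: q)).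
Proof. by case: p => [|x p]; rewrite [rcons _ _]/= ?pedges_cat ?last_rcons. Qed.

(** In the closure all vertices other than [v] are pairwise adjacent, so a cycle through [p] exists
    once [p] fits between two neighbours of [v]. This succeeds if [v] is on [p], or if two
    neighbours of [v] are off [p]. With exactly one neighbour off [p], the other $k$ lie among at
    most $k+1$ path vertices, so an end of [p] is a neighbour. What remains is that [p] consists of
    the neighbours of [v]. *)
Lemma path_covers_neighbors n e v p k : #|V| = n -> symmetric e -> irreflexive e -> 2 < n ->
  p != [::] -> sorted e p -> uniq p -> (size p).-1 <= k -> deg e v = k.+1 ->
  (forall x y, x != v -> y != v -> x != y -> ~~ e x y -> n + k <= deg e x + deg e y) ->
  ~ spanning_cycle e (pedges p) ->
  exists q, [/\ sorted e q, uniq q & q =i [set y | e v y]].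
Proof.
move=> cV sym irr n3 p0 sp up szp dv big nC.
(* For $k = 0$ the neighbourhood is a single vertex, already a path; the counting at the end needs
   $k > 0$. *)
case: (posnP k) => [k0|kpos].
  have /cards1P[x Ex] : #|[set y | e v y]| == 1 by apply/eqP; rewrite -k0.
  by exists [:: x]; rewrite Ex; split=> // y; rewrite !inE.
have [|e' [sym' irr' sb cl dg]] := closure_exists cV sym irr n3 (leq_trans (card_pedges p) szp).
  by move=> x y xy E; apply: (pedges_adj sym sp E).
have cpl x y : x != v -> y != v -> x != y -> e' x y.
  move=> xv yv xy; apply/negPn/negP => nxy.
  have := dg x y xy nxy; rewrite ltnNge; move/negP; apply.
  apply: leq_trans (big x y xv yv xy _) _; first by apply: contra nxy; apply: sb.
  by apply: leq_add; apply: deg_mono.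
set N := [set y | e v y] in dv *.
have vN : v \notin N by rewrite inE irr.
have NP x : x \in N -> x != v by apply: contraTneq => ->.
have cN : #|N| = k.+1 by [].
(* Each case below only has to choose [a], [q1], [q2], [b] so that the two arms at [v] contain the
   edges of [p]. *)
have H a q1 q2 b : uniq (v :: (a :: q1) ++ rcons q2 b) -> a \in N -> b \in N ->
    pedges p \subset [set v; a] |: (pedges (a :: q1) :|: ([set b; v] |: pedges (rcons q2 b))) ->
    False.
  move=> un aN bN sub; rewrite !inE in aN bN.
  have [||c [c1 c2 c3 c4 c5]] := spanning_cycle_through (e := e') _ cpl un (sb _ _ aN).
  - by rewrite cV.
  - by rewrite sym' sb.
  by apply: nC; apply: cl; exists c; split=> //; apply: subset_trans c5.
have szp' : size p <= k.+1 by lia.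
have outN (s : seq V) : uniq s -> size s <= k -> exists2 b, b \in N & b \notin s.
  move=> us ss; have : 0 < #|N :\: [set x in s]|.
    have := cardsID [set x in s] N.
    have : #|N :&: [set x in s]| <= size s.
      rewrite -(card_uniqP us); apply: subset_leq_card; apply/subsetP => x.
      by rewrite !inE => /andP[].
    by rewrite cN; lia.
  by move/card_gt0P => [b]; rewrite !inE => /andP[bs bN]; exists b; rewrite ?inE.
have [vp|vp] := boolP (v \in p).
  exfalso; case/splitPr: vp sp up szp' H {szp p0 nC cl} => p1 p2.
  have p2N a u : sorted e (p1 ++ v :: a :: u) -> a \in N.
    by case: p1 => [|x p1] /=; rewrite ?cat_path /= inE; [case/andP|case/and4P].
  have p1N t b : p1 = rcons t b -> sorted e (p1 ++ v :: p2) -> b \in N.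
    move=> ->; case: t => [|x t] /=; first by case/andP => h _; rewrite inE sym.
    by rewrite cat_path last_rcons => /and3P[_ h _]; rewrite inE sym.
  case: (lastP p1) p1N p2N => [|t b] p1N p2N; case: p2 p1N => [|a u] p1N sp up szp' H.
  - have : 1 < #|N| by rewrite cN.
    move=> /card_gt1P[a [b [aN bN ab]]].
    apply: (H a [::] [::] b) => //; last by rewrite /= pedges1 sub0set.
    by rewrite /= !inE negb_or ab !(eq_sym v) !NP.
  - have [b bN bs] := outN (a :: u) (subseq_uniq (subseq_cons _ _) up) (ltnSE szp').
    apply: (H a u [::] b) => //; last 2 first.
    + exact: p2N sp.
    + by rewrite /= pedges_cons2 setUA subsetUl.
    by rewrite -[v :: _]/((v :: a :: u) ++ [:: b]) cats1 rcons_uniq up inE negb_or bs NP.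
  - have bN := p1N t b erefl sp.
    have := up; rewrite cats1 rcons_uniq => /andP[vtb unb].
    have [a aN aS] : exists2 a, a \in N & a \notin rcons t b.
      by apply: outN => //; move: szp'; rewrite size_cat /= addn1.
    apply: (H a [::] t b) => //.
    + rewrite cat1s [_ :: _ :: _]/= cons_uniq inE negb_or (eq_sym v) NP //= vtb.
      by rewrite aS unb.
    + by rewrite cats1 pedges_rcons2 pedges1 set0U subsetUr.
  apply: (H a u t b).
  - by rewrite -cat_cons uniq_catC.
  - exact: p2N sp.
  - exact: p1N sp.
  rewrite pedges_cat_rcons pedges_cons2; apply/subsetP => E; rewrite !inE.
  by case/or4P => ->; rewrite ?orbT.
have vu (s : seq V) : v \notin s -> uniq s -> forall b, b \in N -> b \notin s -> uniq (v :: s ++ rcons [::] b).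
  move=> vs us b bN bs; rewrite /= cats1 mem_rcons inE negb_or eq_sym NP // vs.
  by rewrite rcons_uniq bs us.
case: p p0 sp up szp' vp H {szp nC cl} => // h t _ sp up szp' vp H.
have Sin x : (x \in [set x in h :: t]) = (x \in h :: t) by rewrite inE.
have [/card_gt1P[a [b [+ + ab]]]|le1] := ltnP 1 #|N :\: [set x in h :: t]|.
  rewrite !in_setD !Sin => /andP[aS aN] /andP[bS bN]; exfalso.
  apply: (H a (h :: t) [::] b) => //.
    apply: (vu (a :: h :: t)) => //.
    - by rewrite in_cons negb_or eq_sym NP.
    - by rewrite cons_uniq aS.
    - by rewrite in_cons negb_or eq_sym ab.
  by rewrite pedges_cons2; apply/subsetP => E EE; rewrite !inE EE !orbT.
have cI := cardsID [set x in h :: t] N.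
have ch : #|[set x in h :: t]| = size (h :: t).
  by rewrite -(card_uniqP up); apply: eq_card => x; rewrite inE.
have [D0|Dn0] := posnP #|N :\: [set x in h :: t]|.
  exists (h :: t); split=> //.
  have sub : N \subset [set x in h :: t] by rewrite -setD_eq0 -cards_eq0 D0.
  have /eqP E : N == [set x in h :: t].
    by rewrite eqEcard sub ch cN.
  by move=> x; rewrite E inE.
have /card_gt0P[b] := Dn0; rewrite in_setD Sin => /andP[bS bN].
have [hN|hN] := boolP (h \in N).
  exfalso; apply: (H h t [::] b) => //; first exact: vu.
  by apply/subsetP => E EE; rewrite !inE EE !orbT.
have [lN|lN] := boolP (last h t \in N).
  exfalso; have Er : rev (h :: t) = last h t :: rev (belast h t) by rewrite lastI rev_rcons.
  apply: (H (last h t) (rev (belast h t)) [::] b) => //; rewrite -Er.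
    by apply: vu; rewrite ?mem_rev ?rev_uniq.
  by rewrite pedges_rev; apply/subsetP => E EE; rewrite !inE EE !orbT.
(* Neither end of [p] is a neighbour, so $k$ neighbours would have to sit among at most $k-1$ inner
   vertices. If the two ends coincide there is no inner vertex at all, which contradicts $k > 0$. *)
exfalso; have sub : N :&: [set x in h :: t] \subset [set x in h :: t] :\ h :\ last h t.
  apply/subsetP => x; rewrite !in_setD1 in_setI => /andP[xN ->]; rewrite andbT.
  by apply/andP; split; apply: contraTneq xN => ->.
have := subset_leq_card sub.
have := cardsD1 h [set x in h :: t]; rewrite Sin mem_head ch.
have := cardsD1 (last h t) ([set x in h :: t] :\ h).
rewrite in_setD1 Sin mem_last andbT.
have : last h t = h -> size t = 0.
  move=> E; apply/eqP; case: (t) E up => // y t' E; rewrite -{1}E cons_uniq.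
  by rewrite [last _ _]/= mem_last.
rewrite [size (h :: t)]/= in szp' *.
case: eqP => [E /(_ E)|_ _]; move: le1 cN cI szp' kpos Dn0; rewrite -/N; clear;
  move: #|N :\: _| #|N :&: _| #|N| #|_ :\ h| #|_ :\ h :\ _| (size t); lia.
Qed.
End LowVertex.

(** * Comparison of the bounds *)

(** [order_bound] over the naturals, with the last branch multiplied by $r-4$, so that the
    comparisons need no division. *)
Definition large_order (r k n : nat) : bool :=
  if r == 3 then 6 * k + 26 <= n
  else if r <= 7 then 6 * k + 2 * r + 3 <= n
  else k * (r - 4) + 4 * (k + 4) + 2 * r * (r - 4) <= n * (r - 4).

Section OrderBound.
Import Order.TTheory GRing.Theory Num.Theory.

Lemma order_bound_large r k n : (order_bound r k <= n%:R)%R -> large_order r k n.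
Proof.
rewrite /order_bound /large_order; case: eqP => _.
  by rewrite -natrM -natrD ler_nat.
case: (leqP r 7) => h.
  by rewrite -!natrM -!natrD ler_nat.
have r4 : (0 < (r%:R - 4 : rat))%R.
  by rewrite subr_gt0 (ltr_nat _ 4 r); lia.
have E : ((r - 4)%:R = r%:R - 4 :> rat)%R by rewrite natrB //; lia.
move=> hn; rewrite -(ler_nat rat) !natrD !natrM E.
rewrite -(ler_pM2r r4) in hn; apply: le_trans hn.
rewrite le_eqVlt; apply/orP; left; apply/eqP.
by field; rewrite gt_eqF.
Qed.

End OrderBound.

(* Here [r = rho + 3], [n = N + 1] and [s = sg + 1]; up to the rounding in the
   Turan numbers, [2 * sg * Q] is [8 * r] times the amount by which the bound for
   [s] is below the one for [s = 1]. *)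
Lemma turan_gap rho k sg dl Q (r := rho + 3) (N := k + 2 + 2 * sg + dl) :
  4 * (k + 2) + Q = 2 * rho * sg + (4 * rho + 8) * dl -> r ^ 2 < 2 * sg * Q ->
  turan_size r (N - sg) + sg.+1 * (sg.+1 + k) < turan_size r N + k.+1.
Proof.
move=> EQ lt; have r0 : 0 < r by rewrite /r addn3.
have := turan_size_lb N r0; have := turan_size_ub (N - sg) r0.
have -> : N - sg = k + 2 + sg + dl by rewrite /N; lia.
have rE : r.-1 = rho + 2 by rewrite /r; lia.
rewrite rE; move: (turan_size _ _) (turan_size _ _) => X Y h1 h2.
have id : 4 * ((rho + 2) * N ^ 2) + 8 * r * k.+1 =
    4 * ((rho + 2) * (k + 2 + sg + dl) ^ 2) + 8 * r * (sg.+1 * (sg.+1 + k)) + 2 * sg * Q.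
  have := congr1 (muln (2 * sg)) EQ; rewrite /N /r -!mulnn; clear; lia.
have r8 : 0 < 8 * r by rewrite muln_gt0.
clearbody r N; rewrite -(ltn_pmul2l r8); clear -h1 h2 id lt.
move: h1 h2 id lt; move: ((_ + dl) ^ 2) (N ^ 2) (r ^ 2) (sg.+1 * _) (2 * sg * Q) => A B C D H.
lia.
Qed.

(** With $s = sg + 1$, [dl] is the slack in [2 * s + k < n]. [turan_gap] needs $16 < 2\,sg\,Q$ for
    $Q = 2sg + 12dl - 4(k+2)$, and the order hypothesis gives $Q \ge k + 11dl$. This lower bound
    vanishes only for $k = dl = 0$; then $sg \ge 4$, and $sg = 4$ is the exception, where $Q =
    0$. *)
Lemma turan_gap_r4 k n s : large_order 4 k n -> 2 <= s -> 2 * s + k < n ->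
  turan_size 4 (n - s) + s * (s + k) < turan_size 4 n.-1 + k.+1 \/
  [/\ n = 11, k = 0 & s = 5].
Proof.
rewrite /large_order /= => hn s2 hs.
have [sg Es] : exists sg, s = sg.+1 by exists s.-1; lia.
have [dl En] : exists dl, n = k + 3 + 2 * sg + dl by exists (n - (k + 3 + 2 * sg)); lia.
have [[d0 [k0 sg4]]|hex] : (dl = 0 /\ k = 0 /\ sg = 4) \/ ~ (dl = 0 /\ k = 0 /\ sg = 4) by lia.
  by right; split; lia.
left; have := @turan_gap 1 k sg dl (2 * sg + 12 * dl - 4 * (k + 2)).
have -> : n.-1 = k + 2 + 2 * sg + dl by lia.
have -> : n - s = k + 2 + 2 * sg + dl - sg by lia.
rewrite Es; apply; first by lia.
have [Q EQ] : exists Q, 2 * sg + 12 * dl = Q + 4 * (k + 2).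
  by exists (2 * sg + 12 * dl - 4 * (k + 2)); lia.
rewrite EQ addnK.
have [d0|dp] := posnP dl; last first.
  by apply: (@leq_trans (2 * 1 * 11)) => //; apply: leq_mul; lia.
case: (ltngtP k 0) => // [kp|k0].
  by apply: (@leq_trans (14 * 2)) => //; apply: leq_mul; lia.
by apply: (@leq_trans (10 * 2)) => //; apply: leq_mul; lia.
Qed.

Lemma turan_gap_r5 r k n s : 5 <= r -> large_order r k n -> 2 <= s -> 2 * s + k < n ->
  turan_size r (n - s) + s * (s + k) < turan_size r n.-1 + k.+1.
Proof.
move=> r5; rewrite /large_order; case: eqP => [|_]; first by lia.
move=> hn s2 hs.
have [sg Es] : exists sg, s = sg.+1 by exists s.-1; lia.
have [dl En] : exists dl, n = k + 3 + 2 * sg + dl by exists (n - (k + 3 + 2 * sg)); lia.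
have [rho Er] : exists rho, r = rho + 3 by exists (r - 3); lia.
have -> : n.-1 = k + 2 + 2 * sg + dl by lia.
have -> : n - s = k + 2 + 2 * sg + dl - sg by lia.
have sg1 : 1 <= sg by lia.
rewrite Es Er; case: (leqP r 7) hn => r7 hn.
  have [|[|]] : rho = 2 \/ rho = 3 \/ rho = 4 by lia.
  - move=> E; rewrite E; apply: (@turan_gap 2 k sg dl (4 * sg + 16 * dl - 4 * (k + 2))); first by lia.
    have [sg2|sg2] := leqP 2 sg.
      by apply: (@leq_trans (4 * 12)) => //; apply: leq_mul; lia.
    by apply: (@leq_trans (2 * 20)) => //; apply: leq_mul; lia.
  - move=> E; rewrite E; apply: (@turan_gap 3 k sg dl (6 * sg + 20 * dl - 4 * (k + 2))); first by lia.
    by apply: (@leq_trans (2 * 20)) => //; apply: leq_mul; lia.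
  - move=> E; rewrite E; apply: (@turan_gap 4 k sg dl (8 * sg + 24 * dl - 4 * (k + 2))); first by lia.
    by apply: (@leq_trans (2 * 30)) => //; apply: leq_mul; lia.
(* Now $r = d + 8$, and $2d + 13$ below is $2r - 3$. The order hypothesis gives $Q \ge 10 +
   (2d+13)(d+4)$, and twice this exceeds $r^2$. *)
have [d Ed] : exists d, rho = d + 5 by exists (rho - 5); lia.
move: hn; rewrite En Er Ed; have -> : d + 5 + 3 - 4 = d + 4 by lia.
move=> hn.
have hn' : 4 * k + 16 + (2 * d + 13) * (d + 4) <= (2 * sg + dl) * (d + 4) by move: hn; clear; lia.
have hQ : 4 * (k + 2) + (2 * sg + dl + 8 + (2 * d + 13) * (d + 4)) <= (2 * sg + dl) * (d + 5).
  by move: hn'; clear; lia.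
pose Q := 2 * (d + 5) * sg + (4 * (d + 5) + 8) * dl - 4 * (k + 2).
have QE : 4 * (k + 2) + Q = 2 * (d + 5) * sg + (4 * (d + 5) + 8) * dl.
  have : 4 * (k + 2) <= 2 * (d + 5) * sg + (4 * (d + 5) + 8) * dl by move: hQ; clear; lia.
  by rewrite /Q => /subnKC.
apply: (turan_gap QE).
have hQ' : 2 * (10 + (2 * d + 13) * (d + 4)) <= 2 * sg * Q.
  by apply: leq_mul; [lia|move: QE hQ sg1; clear; lia].
by apply: leq_trans hQ'; rewrite -mulnn; clear; lia.
Qed.

(** For $r = 3$ the term $2\,rho\,sg$ of [turan_gap] vanishes, so everything rests on the slack
    [dl], which is large when $s = 2$. *)
Lemma turan_gap_r3_s2 k n : large_order 3 k n ->
  turan_size 3 (n - 2) + 2 * (2 + k) < turan_size 3 n.-1 + k.+1.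
Proof.
rewrite /large_order /= => hn.
have [dl En] : exists dl, n = k + 5 + dl by exists (n - (k + 5)); lia.
have -> : n.-1 = k + 2 + 2 * 1 + dl by lia.
have -> : n - 2 = k + 2 + 2 * 1 + dl - 1 by lia.
by apply: (@turan_gap 0 k 1 dl (8 * dl - 4 * (k + 2))); lia.
Qed.

(** The left-hand side bounds $12e(G)$: [triangle_packing_bound] covers the vertices outside the low
    set, and the degree bound $s + k$ covers the $s$ low vertices. *)
Lemma turan_gap_r3 k n s : large_order 3 k n -> 3 <= s -> 2 * s + k < n ->
  (2 * (n - s) + s) ^ 2 + 6 * (s * (s + k)) < 12 * (turan_size 3 n.-1 + k.+1).
Proof.
rewrite /large_order /= => hn s3 hs.
have [t Et] : exists t, s = t + 2 by exists (s - 2); lia.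
have [dl En] : exists dl, n = k + 5 + 2 * t + dl by exists (n - (k + 5 + 2 * t)); lia.
have := turan_size_closed n.-1 (isT : 0 < 3).
have := ltn_pmod n.-1 (isT : 0 < 3).
move: (_ %% _) => u lt; have hu : u * (3 - u) <= 2 by case: u lt => [|[|[|]]].
move: (turan_size _ _) (u * _) hu => X c hc.
have -> : n.-1 = k + 4 + 2 * t + dl by lia.
have -> : n - s = k + 3 + t + dl by lia.
(* What is left of the claim after cancellation; 16 is $12 + 2c$ at the largest rounding term $c =
   2$. *)
have key : 16 + t * (8 + 2 * k) < t * (t + 4 * dl).
  have [t6|t6] := leqP 6 t.
    apply: (@leq_trans (t * (8 + 2 * k + 3))); last by rewrite leq_mul2l; apply/orP; right; lia.
    by move: t6; clear; lia.
  apply: (@leq_trans (t * (8 + 2 * k + 17))); last by rewrite leq_mul2l; apply/orP; right; lia.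
  have tp : 0 < t by lia.
  by move: tp; clear; lia.
rewrite Et -!mulnn; move: key hc; clear; lia.
Qed.

(** * Edge counts and isomorphisms *)

Lemma deg_in_setT (V : finType) (e : rel V) x : deg_in e setT x = deg e x.
Proof. by apply: eq_card => y; rewrite !inE. Qed.

Lemma deg_sum_setTE (V : finType) (e : rel V) : deg_sum e setT = \sum_x \sum_y e x y.
Proof.
rewrite /deg_sum; apply: eq_big => [x|x _]; rewrite ?inE // deg_inE.
by apply: eq_bigl => y; rewrite inE.
Qed.

Lemma handshake (G : sgraph) : 2 * nb_edges G = deg_sum (@adj G) setT.
Proof.
rewrite deg_sum_setTE pair_big /=.
under eq_bigr => u _ do rewrite -[nat_of_bool _]/(nat_of_bool (adj u.1 u.2)).
rewrite -(big_mkcond (fun u : G * G => adj u.1 u.2) (fun=> 1)) /=.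
rewrite (partition_big_imset (fun u : G * G => [set u.1; u.2])) /=.
rewrite /nb_edges mulnC -sum_nat_const; apply: eq_bigr => E /imsetP[[a b] ab ->].
rewrite sum1_card; have ab' : adj a b by [].
have nab : a != b by apply: contraTneq ab' => ->; rewrite adj_irrefl.
have -> : 2 = #|[set (a, b); (b, a)]|.
  by rewrite cards2 xpair_eqE (negbTE nab).
apply: eq_card => -[x y]; rewrite !inE !xpair_eqE unfold_in /=.
apply/orP/andP => [[]/andP[/eqP -> /eqP ->]|[xy /eqP E']].
- by split.
- by split; [rewrite unfold_in /= adj_sym|rewrite setUC].
rewrite unfold_in /= in xy.
have nxy : x != y by apply: contraTneq xy => ->; rewrite adj_irrefl.
have : x \in [set a; b] by rewrite -E' set21.
have : y \in [set a; b] by rewrite -E' set22.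
by move=> /set2P[] Ey /set2P[] Ex; move: nxy; rewrite Ex Ey ?eqxx; [|right|left|].
Qed.

Lemma isomorphic_nb_edges (G H : sgraph) : isomorphic G H -> nb_edges G = nb_edges H.
Proof.
move=> [f bij fE]; apply/eqP; rewrite -(eqn_pmul2l (isT : 0 < 2)) !handshake !deg_sum_setTE.
rewrite [X in _ == X](reindex f) /=; last exact: onW_bij.
apply/eqP; apply: eq_bigr => x _; rewrite [RHS](reindex f) /=; last exact: onW_bij.
by apply: eq_bigr => y _; rewrite fE.
Qed.

Lemma deg_sum_induced (G : sgraph) (S : {set G}) :
  deg_sum (@adj (induced S)) setT = deg_sum (@adj G) S.
Proof.
rewrite deg_sum_setTE /deg_sum (big_sub (mem S)) /=; apply: eq_bigr => x _.
by rewrite deg_inE (big_sub (mem S)) /=; apply: eq_bigr.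
Qed.

(** The non-neighbours of a vertex, itself included, form its colour class. *)
Lemma color_deg_sum (V I : finType) (e : rel V) (c : V -> I) :
  (forall x y, e x y = (c x != c y)) ->
  deg_sum e setT + \sum_a #|[set x | c x == a]| ^ 2 = #|V| ^ 2.
Proof.
move=> ce; have Es : \sum_(a : I) #|[set x | c x == a]| ^ 2 =
    \sum_(a in [set: I]) #|[set x in [set: V] | c x == a]| ^ 2.
  apply: eq_big => [a|a _]; rewrite ?inE //; congr (_ ^ 2).
  by apply: eq_card => x; rewrite !inE.
rewrite Es -(@sum_color_sq _ _ _ c setT) /deg_sum; last by move=> x; rewrite inE.
rewrite -big_split /= (eq_bigr (fun=> #|V|)) ?sum_nat_const ?cardsT ?mulnn // => x _.
rewrite deg_in_setT /deg addnC -(cardsC [set y | c y == c x]); congr (_ + _).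
  by apply: eq_card => y; rewrite !inE.
by apply: eq_card => y; rewrite !inE ce eq_sym.
Qed.

Lemma card_residue r m a : a < r -> \sum_(x < m) (x %% r == a) = m %/ r + (a < m %% r).
Proof.
move=> ar; have r0 : 0 < r by exact: leq_ltn_trans ar.
elim: m => [|m IH]; first by rewrite big_ord0 div0n mod0n.
rewrite big_ord_recr /= IH.
have lt := ltn_pmod m r0; have Em := divn_eq m r.
have [h|h] := ltnP (m %% r).+1 r.
  have -> : m.+1 %/ r = m %/ r by rewrite {1}Em -addnS divnMDl // (divn_small h) addn0.
  have -> : m.+1 %% r = (m %% r).+1 by rewrite {1}Em -addnS modnMDl modn_small.
  by rewrite -addnA; congr (_ + _); rewrite ltnS [a <= _]leq_eqVlt eq_sym; case: eqP => [->|_]; rewrite ?ltnn ?addn0.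
have E : (m %% r).+1 = r by lia.
have -> : m.+1 %/ r = (m %/ r).+1 by rewrite {1}Em -addnS E divnMDl // divnn r0 addn1.
have -> : m.+1 %% r = 0 by rewrite {1}Em -addnS E modnMDl modnn.
have -> : (a < m %% r) = (a != m %% r) by rewrite ltn_neqAle -ltnS E ar andbT.
by rewrite eq_sym ltn0 addn0 -addnA -addn1; case: (_ == _).
Qed.

Lemma turan_nb_edges r m : 0 < r -> nb_edges (turan r m) = turan_size r m.
Proof.
move=> r0; apply/eqP; rewrite -(eqn_pmul2l (isT : 0 < 2)) handshake deg_sum_setTE /=.
apply/eqP; rewrite /turan_adj; elim: m => [|m IH]; first by rewrite big_ord0 /turan_size big_ord0.
have nr : \sum_(x < m) (x %% r != m %% r) = m - m %/ r.
  have := card_residue m (ltn_pmod m r0); rewrite ltnn addn0 => Em.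
  have : \sum_(x < m) (x %% r != m %% r) + \sum_(x < m) (x %% r == m %% r) = m.
    rewrite -big_split /= (eq_bigr (fun=> 1)) ?sum1_card ?card_ord // => x _.
    by case: (_ == _).
  by rewrite Em; lia.
rewrite turan_sizeS big_ord_recr /= big_ord_recr /= eqxx addn0.
under eq_bigr do rewrite big_ord_recr /=.
rewrite big_split /= IH nr.
under [\sum_(x < m) (m %% r != x %% r)]eq_bigr do rewrite eq_sym.
by rewrite nr; lia.
Qed.

Lemma card_tag_fiber (I : finType) (T : I -> finType) (i : I) :
  #|[set p : {i : I & T i} | tag p == i]| = #|T i|.
Proof.
rewrite -sum1_card (eq_bigl (fun p : {i : I & T i} => (tag p == i) && true)); last first.
  by move=> p; rewrite inE andbT.
rewrite -(sig_big_dep (fun j => j == i) (fun _ => predT) (fun _ _ => 1)) /=.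
by rewrite big_pred1_eq sum1_card.
Qed.

(** Each class is sent to its partner under [h] position by position along the enumerations; [y0] is
    only the default of [nth]. The map is injective, and the cardinality hypothesis makes it
    bijective. *)
Lemma color_isomorphic (G H : sgraph) (I J : eqType) (c : G -> I) (d : H -> J)
    (h : I -> J) (y0 : H) :
  (forall x y, adj x y = (c x != c y)) -> (forall x y, adj x y = (d x != d y)) ->
  (forall x, #|[set x' | c x' == c x]| = #|[set y | d y == h (c x)]|) ->
  (forall x x', h (c x) = h (c x') -> c x = c x') -> #|H| <= #|G| ->
  isomorphic G H.
Proof.
move=> ce de cd hi le.
pose A x := enum [set x' | c x' == c x]; pose B x := enum [set y | d y == h (c x)].
pose f x := nth y0 (B x) (index x (A x)).
have xA x : x \in A x by rewrite mem_enum inE.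
have sAB x : size (A x) = size (B x) by rewrite -!cardE.
have lt x : index x (A x) < size (B x) by rewrite -sAB index_mem.
have df x : d (f x) = h (c x).
  by have := mem_nth y0 (lt x); rewrite mem_enum inE => /eqP.
have fi : injective f.
  move=> x x' E; have cx : c x = c x' by apply: hi; rewrite -!df E.
  have EA : A x = A x' by rewrite /A cx.
  have EB : B x = B x' by rewrite /B cx.
  have := E; rewrite /f -EB -EA => /eqP; rewrite nth_uniq ?enum_uniq ?lt //; last first.
    by rewrite EB EA lt.
  move=> /eqP Ei; rewrite -(nth_index x (xA x)) Ei.
  by rewrite nth_index // EA.
exists f; first exact: inj_card_bij.
move=> x y; rewrite de ce !df; congr negb; apply/eqP/eqP => [|-> //]; exact: hi.
Qed.

Lemma clique_free_has_clique (G : sgraph) s (R : {set G}) :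
  clique_free s G -> ~~ has_clique (@adj G) R s.
Proof.
move=> cf; apply/negP => /has_cliqueP[A [_ cA /cliqueP kA]].
exact: (cf A cA).
Qed.

Lemma not_path_hamiltonian_path (G : sgraph) k : ~ path_hamiltonian k G ->
  exists p : seq G, [/\ is_path p, (size p).-1 <= k & ~ spanning_cycle (@adj G) (pedges p)].
Proof.
move=> nH; apply: NNPP => nE; apply: nH => p pp sp; apply: NNPP => nC.
apply: nE; exists p; split=> // -[c [sz cy un full sub]]; apply: nC.
exists c; first by split=> //; apply/and3P.
by split=> [x _|//]; apply: full.
Qed.

Lemma traceable_of_path (G : sgraph) (S : {set G}) (q : seq G) :
  q != [::] -> sorted adj q -> uniq q -> q =i S -> traceable (induced S).
Proof.
move=> q0 sq uq qS.
have [p Ep] : exists p : seq (induced S), map val p = q.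
  have : {subset q <= S} by move=> x; rewrite qS.
  elim: q {q0 sq uq qS} => [|x q IH] sub; first by exists [::].
  have [|p <-] := IH; first by move=> y yq; apply: sub; rewrite inE yq orbT.
  by exists (Sub x (sub x (mem_head _ _)) :: p).
exists p; split.
  apply/and3P; split.
  - by apply: contraNneq q0 => p0; rewrite -Ep p0.
  - by move: sq; rewrite -Ep sorted_map.
  - by rewrite -(map_inj_uniq val_inj) Ep.
by move=> x; rewrite -(mem_map val_inj) Ep qS; apply: valP.
Qed.

Lemma card_set_sum (V : finType) (P : pred V) : #|[set x | P x]| = \sum_x P x.
Proof.
rewrite -sum1_card big_mkcond; apply: eq_bigr => x _.
by rewrite inE; case: (P x).
Qed.

Lemma card_induced_set (G : sgraph) (S : {set G}) (P : pred G) :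
  #|[set x : induced S | P (val x)]| = #|[set y in S | P y]|.
Proof.
rewrite card_set_sum -(big_sub (mem S) (fun y => nat_of_bool (P y))) /=.
rewrite card_set_sum big_mkcond; apply: eq_bigr => y _.
by case: (y \in S).
Qed.

Lemma turan_isomorphic (G : sgraph) (S : {set G}) r m : #|S| = m -> 0 < r <= m ->
  ~~ has_clique (@adj G) S r.+1 -> deg_sum (@adj G) S = 2 * turan_size r m ->
  isomorphic (induced S) (turan r m).
Proof.
move=> cS rm nC dS.
have [r0 rle] := andP rm; have m0 : 0 < m by apply: leq_trans rle.
have [||A [c [cA cS_A ce cf]]] :=
  turan_extremal (@adj_sym G) (@adj_irrefl G) (R := S) _ nC; rewrite ?cS //.
rewrite cS in cf.
pose fib a := [set y in S | c y == a].
pose B := [set a in A | #|fib a| == (m %/ r).+1].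
have BA : B \subset A by apply/subsetP => a; rewrite inE => /andP[].
have fibE a : a \in A -> #|fib a| = m %/ r + (a \in B).
  move=> aA; rewrite inE aA /=; case: (cf a aA) => E; rewrite /fib E ?eqxx ?addn1 //.
  by rewrite eqn_leq ltnn andbF addn0.
have cB : #|B| = m %% r.
  have : m = \sum_(a in A) #|fib a| by rewrite -(sum_color cS_A).
  rewrite (eq_bigr (fun a => m %/ r + (a \in B))) => [|a aA]; last exact: fibE.
  rewrite big_split /= sum_nat_const cA -big_mkcondr /= sum1_card.
  have -> : #|[pred a in A | a \in B]| = #|B|.
    by apply: eq_card => a; rewrite !inE andbA andbb.
  by rewrite {1}(divn_eq m r) mulnC => /addnI.
(* The large classes come first, because the residues below [m %% r] are the ones with [(m %/ r).+1]
   members. *)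
pose l := enum B ++ enum (A :\: B).
have ml a : (a \in l) = (a \in A).
  rewrite mem_cat !mem_enum in_setD; case: (boolP (a \in B)) => //= aB.
  by rewrite (subsetP BA).
have sl : size l = r by rewrite size_cat -!cardE -cA (card_setD_sub BA).
pose h a := index a l.
have hlt a : a \in A -> h a < r by move=> aA; rewrite -sl index_mem ml.
have hB a : (h a < m %% r) = (a \in B).
  rewrite /h /l index_cat mem_enum -cB; case: (boolP (a \in B)) => aB.
    by rewrite cardE index_mem mem_enum.
  by rewrite -cardE ltnNge leq_addr.
apply: (@color_isomorphic _ _ _ _ (fun x : induced S => c (val x))
  (fun y : turan r m => y %% r) h (Ordinal m0)).
- by move=> x y; rewrite /= /induced_adj ce ?(valP x) ?(valP y).
- by move=> x y.
- move=> x; have xA := cS_A _ (valP x).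
  rewrite (card_induced_set S (fun y => c y == c (val x))) -/(fib _).
  by rewrite fibE // -hB -card_residue ?hlt // card_set_sum.
- move=> x x' E; have xA := cS_A _ (valP x).
  have Nx a : a \in A -> nth (c (val x)) l (h a) = a.
    by move=> aA; rewrite /h nth_index // ml.
  by rewrite -(Nx _ xA) E Nx //; apply: cS_A (valP x').
- by rewrite card_ord card_sig; apply: eq_leq; rewrite -cS; apply: eq_card.
Qed.

(** Once the rest of the graph is $T_r(n-1)$, a vertex there misses at most its class, of size at
    most $q+1$. The right-hand side is thus a lower bound for degree sums, as
    [path_covers_neighbors] requires. *)
Lemma large_order_degree_sum r k n q : 3 <= r -> large_order r k n -> q = n.-1 %/ r ->
  n + k <= 2 * (n.-1 - q.+1).
Proof.
rewrite /large_order => r3 + Eq.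
have : q * r <= n.-1 by rewrite Eq leq_trunc_div.
case: eqP => [->|r3']; first by lia.
case: (leqP r 7) => r7 hq hn.
  have : q * 4 <= n.-1 by apply: leq_trans hq; rewrite leq_mul2l; lia.
  lia.
have [d Ed] : exists d, r = d + 8 by exists (r - 8); lia.
have h4 : r - 4 = d + 4 by lia.
rewrite h4 Ed in hn; rewrite Ed in hq.
have h1 : q * 8 + q * d <= n.-1 by rewrite -mulnDr addnC addnC [8 + d]addnC.
have h2 : (k + 4) * (d + 4) <= n * (d + 2).
  rewrite -(leq_pmul2r (_ : 0 < d + 4)); last by lia.
  have : (d + 2) * (k * (d + 4) + 4 * (k + 4) + 2 * (d + 8) * (d + 4)) <= (d + 2) * (n * (d + 4)).
    by rewrite leq_mul2l hn orbT.
  by clear; lia.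
suff : k + 2 * q + 4 <= n by lia.
rewrite -(leq_pmul2r (_ : 0 < d + 4)); last by lia.
have h3 : q * 8 + q * d <= n by apply: leq_trans h1 (leq_pred n).
by move: h2 h3; clear; lia.
Qed.

(** [k + k %/ r.-1] is the last of the first $k+1$ naturals not congruent to $r-1$ modulo $r$; it
    must be a vertex of $T_r(n-1)$ for [in_J_exists]. *)
Lemma large_order_facts r k n : 3 <= r -> large_order r k n -> 2 * r <= n /\ k + k %/ r.-1 < n.-1.
Proof.
rewrite /large_order => r3.
have h0 : k %/ r.-1 * 2 <= k.
  apply: leq_trans (leq_trunc_div k r.-1); rewrite leq_mul2l; lia.
case: eqP => [->|r3']; first by lia.
case: (leqP r 7) => r7 hn; first by lia.
have h1 : k %/ r.-1 * r.-1 <= k by apply: leq_trunc_div.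
have [d Ed] : exists d, r = d + 8 by exists (r - 8); lia.
move: hn h1; have -> : r - 4 = d + 4 by lia.
have -> : r.-1 = d + 7 by lia.
rewrite {}Ed; move: (k %/ _) => q hn h1.
split; first by rewrite -(leq_pmul2r (_ : 0 < d + 4)); lia.
have : (k + q).+2 <= n; last by lia.
rewrite -(leq_pmul2r (_ : 0 < d + 4)); last by lia.
by apply: leq_trans hn; lia.
Qed.

(** * The extremal graphs *)

Lemma nb_edges_remove (G : sgraph) (v : G) :
  2 * nb_edges G = deg_sum (@adj G) [set~ v] + 2 * deg (@adj G) v.
Proof.
rewrite handshake (deg_sum_setD (@adj_sym G) (subsetT [set v])) setTD.
rewrite -(deg_inC (@adj_sym G)) /deg_sum !big_set1.
have d0 : deg_in (@adj G) [set v] v = 0 by rewrite deg_inE big_set1 adj_irrefl.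
have := deg_in_setD (@adj G) v (subsetT [set v]).
by rewrite deg_in_setT setTD d0 !add0n => ->.
Qed.

Lemma in_J_nb_edges (k n r : nat) (G : sgraph) : in_J k n r G ->
  nb_edges G = nb_edges (turan r n.-1) + k.+1.
Proof.
move=> [_ _ [v [/isomorphic_nb_edges <- dv _]]].
have := nb_edges_remove v; rewrite -deg_sum_induced -handshake.
have -> : deg (@adj G) v = k.+1 by [].
lia.
Qed.

Lemma low_vertex_extremal n r k (G : sgraph) (v : G) (p : seq G) :
  #|G| = n -> 3 <= r -> large_order r k n -> clique_free r.+1 G ->
  is_path p -> (size p).-1 <= k -> ~ spanning_cycle (@adj G) (pedges p) ->
  deg (@adj G) v <= k.+1 ->
  nb_edges G <= nb_edges (turan r n.-1) + k.+1 /\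
  (nb_edges G = nb_edges (turan r n.-1) + k.+1 -> in_J k n r G).
Proof.
move=> cG r3 hn cf /and3P[p0 sp up] szp nC dv.
have r0 : 0 < r by apply: leq_trans r3.
have [h2r _] := large_order_facts r3 hn.
have nK := @clique_free_has_clique G r.+1 [set~ v] cf.
have cR : #|[set~ v]| = n.-1 by rewrite cardsC1 cG.
have ub := turan_bound (@adj_sym G) (@adj_irrefl G) r0 nK.
have E := nb_edges_remove v; rewrite turan_nb_edges // cR in ub *.
split; first by lia.
move=> Eq.
have dR : deg_sum (@adj G) [set~ v] = 2 * turan_size r n.-1 by lia.
have dv' : deg (@adj G) v = k.+1 by lia.
have rle : 0 < r <= n.-1 by lia.
split=> //; exists v; split=> //; first exact: turan_isomorphic.
have [||A [c [cA cRA ce cfib]]] :=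
  turan_extremal (@adj_sym G) (@adj_irrefl G) (R := [set~ v]) _ nK; rewrite ?cR //.
rewrite cR in cfib.
have [|x y xv yv xy nxy|q [sq uq qN]] := path_covers_neighbors cG (@adj_sym G)
  (@adj_irrefl G) _ p0 sp up szp dv' _ nC.
- lia.
- have lowdeg z : z != v -> n.-1 - (n.-1 %/ r).+1 <= deg (@adj G) z.
    move=> zv; have zR : z \in [set~ v] by rewrite !inE.
    have : #|[set y in [set~ v] | c y == c z]| <= (n.-1 %/ r).+1.
      by case: (cfib (c z) (cRA z zR)) => ->.
    have := cardsID [set y | adj z y] [set~ v]; rewrite cR => <-.
    have -> : [set~ v] :\: [set y | adj z y] = [set y in [set~ v] | c y == c z].
      apply/setP => w; rewrite in_setD [in RHS]inE andbC.
      case: (boolP (w \in [set~ v])) => //= wR.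
      by rewrite inE ce // negbK eq_sym.
    have : #|[set~ v] :&: [set y | adj z y]| <= deg (@adj G) z.
      by apply: subset_leq_card; apply: subsetIr.
    by move=> h1 h2; rewrite leq_subLR [X in _ <= X]addnC; apply: leq_add.
  have := large_order_degree_sum r3 hn erefl; have := lowdeg x xv; have := lowdeg y yv.
  by move: (_ - _) (deg _ _) (deg _ _); clear; lia.
apply: (traceable_of_path (q := q)) => //.
apply/eqP => q0; have : #|[set y | adj v y]| = 0.
  by apply/eqP; rewrite cards_eq0; apply/eqP/setP => y; rewrite -qN q0 inE.
by rewrite -/(deg _ v) dv'.
Qed.

(** * The exceptional graph $K_{6,2,2,1}$ *)

Lemma nb_edges_K6221 : nb_edges (complete_multipartite [:: 6; 2; 2; 1]) = 38.
Proof.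
set H := complete_multipartite _.
have := @color_deg_sum H 'I_4 (@adj H) (fun p => tag p) (fun _ _ => erefl).
have -> : #|H| = 11.
  by rewrite card_tagged sumnE big_map big_enum /= !big_ord_recr big_ord0 /= !card_ord.
rewrite -handshake.
under eq_bigr do rewrite (card_tag_fiber (fun i : 'I_4 => 'I_(nth 0 [:: 6; 2; 2; 1] i))) card_ord.
rewrite !big_ord_recr big_ord0 /= => E; lia.
Qed.

Lemma colored_isomorphic_K6221 (G : sgraph) (c : G -> G) (l : seq G) :
  uniq l -> size l = 4 -> (forall x, c x \in l) ->
  (forall x y, adj x y = (c x != c y)) -> #|G| = 11 ->
  (forall x, #|[set y | c y == c x]| = nth 0 [:: 6; 2; 2; 1] (index (c x) l)) ->
  isomorphic G (complete_multipartite [:: 6; 2; 2; 1]).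
Proof.
move=> ul sl cl ce cG fib; set H := complete_multipartite _.
have y0 : H by exists (ord0 : 'I_4); exact: (ord0 : 'I_6).
apply: (@color_isomorphic G H G nat c (fun p : H => val (tag p)) (fun a => index a l) y0) => //.
- move=> x; have lt : index (c x) l < 4 by rewrite -sl index_mem.
  by rewrite fib -(card_ord (nth 0 [:: 6; 2; 2; 1] (Ordinal lt)))
    -(card_tag_fiber (fun i : 'I_4 => 'I_(nth 0 [:: 6; 2; 2; 1] i)) (Ordinal lt)).
- by move=> x x' E; rewrite -(nth_index (c x) (cl x)) E nth_index.
- rewrite cG card_tagged sumnE big_map big_enum /= !big_ord_recr big_ord0 /= !card_ord //.
Qed.

Lemma deg_sum_split (G : sgraph) (S : {set G}) :
  2 * nb_edges G + deg_sum (@adj G) S =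
  deg_sum (@adj G) (~: S) + 2 * \sum_(x in S) deg (@adj G) x.
Proof.
rewrite handshake (deg_sum_setD (@adj_sym G) (subsetT S)) setTD.
rewrite -(deg_inC (@adj_sym G)).
under [in RHS]eq_bigr do rewrite -deg_in_setT (deg_in_setD _ _ (subsetT S)) setTD.
by rewrite big_split /= -/(deg_sum _ S); lia.
Qed.

(** Edges leaving [S] are counted once from either end, which is the combination that
    [triangle_packing_bound] controls. *)
Lemma deg_sum_split_half (G : sgraph) (S : {set G}) :
  2 * nb_edges G = deg_sum (@adj G) (~: S) +
    \sum_(x in ~: S) deg_in (@adj G) S x + \sum_(x in S) deg (@adj G) x.
Proof.
rewrite handshake (deg_sum_setD (@adj_sym G) (subsetT S)) setTD.
rewrite -(deg_inC (@adj_sym G)).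
under [X in _ = _ + X]eq_bigr do rewrite -deg_in_setT (deg_in_setD _ _ (subsetT S)) setTD.
by rewrite big_split /= -/(deg_sum _ S); lia.
Qed.

(** Since $38 = 13 + 25$, all estimates are tight: the complement [R] of [S] spans $T_4(6)$, with
    parts 2, 2, 1, 1, [S] is independent, and each of its vertices misses one vertex of [R]. A sixth
    vertex [y] of degree at most 5 lies in [R]; its part is a singleton, which already gives it five
    neighbours in [R]. So [y] is the vertex that all of [S] misses and joins [S] in a part of size
    6. *)
Lemma isomorphic_K6221 (G : sgraph) (S : {set G}) : #|G| = 11 -> clique_free 5 G ->
  #|S| = 5 -> {in S, forall x, deg (@adj G) x <= 5} ->
  6 <= #|[set x | deg (@adj G) x <= 5]| -> nb_edges G = 38 ->
  isomorphic G (complete_multipartite [:: 6; 2; 2; 1]).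
Proof.
move=> cG cf cS dS d6 eG; set e := @adj G in dS d6 *; set R := ~: S.
have sym : symmetric e := @adj_sym G.
have irr : irreflexive e := @adj_irrefl G.
have cR : #|R| = 6 by have := cardsC S; rewrite cS -/R cG => -[].
have nK T : ~~ has_clique e T 5 by apply: clique_free_has_clique.
have ub T : deg_sum e T <= 2 * turan_size 4 #|T| by apply: turan_bound.
have T6 : turan_size 4 6 = 13 by rewrite /turan_size !big_ord_recr big_ord0.
have ubR := ub R; rewrite cR T6 in ubR.
have sS : \sum_(x in S) deg e x <= 25.
  by rewrite -[25]/(5 * 5) -{1}cS -sum_nat_const; apply: leq_sum.
have E := deg_sum_split S; rewrite eG -/R -/e in E.
have dR : deg_sum e R = 26 by lia.
have sS25 : \sum_(x in S) deg e x = 25 by lia.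
have dsS : deg_sum e S = 0 by lia.
have deg5 x : x \in S -> deg e x = 5.
  move=> xS; apply/eqP; rewrite eqn_leq dS //=.
  move: sS25; rewrite (big_setD1 x) //=.
  have : \sum_(y in S :\ x) deg e y <= #|S :\ x| * 5.
    by rewrite -sum_nat_const; apply: leq_sum => y /setD1P[_]; apply: dS.
  by have := cardsD1 x S; rewrite xS cS add1n => -[<-]; lia.
have degS x : x \in S -> deg_in e S x = 0.
  by move=> xS; move: dsS; rewrite /deg_sum (big_setD1 x) //=; lia.
have degE x : deg e x = deg_in e S x + deg_in e R x.
  by rewrite -deg_in_setT (deg_in_setD _ _ (subsetT S)) setTD.
have degR x : x \in S -> deg_in e R x = 5.
  by move=> xS; have := deg5 x xS; rewrite degE degS.
have [y yR dy] : exists2 y, y \in R & deg e y <= 5.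
  have : 0 < #|[set x | deg e x <= 5] :\: S|.
    have := cardsID S [set x | deg e x <= 5].
    have : #|[set x | deg e x <= 5] :&: S| <= 5.
      by rewrite -cS; apply: subset_leq_card; apply: subsetIr.
    by move: d6; lia.
  by move=> /card_gt0P[y]; rewrite !inE => /andP[yS dy]; exists y; rewrite // inE.
have [||A [c [cA cRA ce cfib]]] := turan_extremal sym irr (R := R) _ (nK R); rewrite ?cR ?T6 //.
rewrite cR -[6 %/ 4]/1 in cfib.
pose fib a := [set x in R | c x == a].
have degRR x : x \in R -> deg_in e R x + #|fib (c x)| = 6.
  move=> xR; rewrite -cR -(cardsID [set z | e x z] R); congr (_ + _).
    by apply: eq_card => z; rewrite !inE.
  apply: eq_card => z; rewrite in_setD [in LHS]inE andbC.
  case: (boolP (z \in R)) => zR; rewrite ?andbF ?andbT //.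
  by rewrite inE ce // negbK eq_sym.
have fy1 : #|fib (c y)| = 1.
  case: (cfib (c y) (cRA y yR)) => // f2; exfalso.
  have dRy : deg_in e R y = 4 by have := degRR y yR; rewrite /fib f2; lia.
  have [x xS nxy] : exists2 x, x \in S & ~~ e x y.
    apply/exists_inP; apply: contraLR dy => /exists_inPn al.
    have : deg_in e S y = 5.
      rewrite -cS; apply: eq_card => x; rewrite inE.
      case: (boolP (x \in S)) => //= /al; rewrite negbK sym //.
    by rewrite -ltnNge degE dRy => ->.
  have xR : x \notin R by rewrite inE negbK.
  (* Exchanging [y] for [x] raises the degree sum from 26 to 28, above the Turan bound. *)
  pose T := x |: (R :\ y).
  have xRy : x \notin R :\ y by rewrite inE negb_and xR orbT.
  have cT : #|T| = 6 by rewrite cardsU1 xRy -cR (cardsD1 y R) yR.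
  have := ub T; rewrite cT T6.
  rewrite (deg_sum_setD sym (subsetUl [set x] (R :\ y))).
  have -> : (x |: (R :\ y)) :\: [set x] = R :\ y.
    by apply/setP => z; rewrite !inE; case: eqP => [->|//]; rewrite xS andbF.
  rewrite -(deg_inC sym) big_set1.
  have dx : deg_in e (R :\ y) x = 5.
    rewrite -(degR x xS); apply: eq_card => z; rewrite !inE.
    by case: eqP => [->|//]; rewrite (negbTE nxy) !andbF.
  have := deg_sum_setD sym (_ : [set y] \subset R); rewrite sub1set => /(_ yR).
  rewrite -(deg_inC sym) big_set1 dR dx.
  have := deg_in_setD e y (_ : [set y] \subset R); rewrite sub1set => /(_ yR).
  have -> : deg_in e [set y] y = 0 by rewrite deg_inE big_set1 irr.
  rewrite dRy /deg_sum !big_set1.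
  have -> : deg_in e [set y] y = 0 by rewrite deg_inE big_set1 irr.
  lia.
have nyS x : x \in S -> ~~ e x y.
  move=> xS; apply/negP => xy.
  have : 0 < deg_in e S y by apply/card_gt0P; exists x; rewrite inE xS sym.
  by have := degRR y yR; move: dy; rewrite degE fy1; lia.
have NxR x : x \in S -> [set z in R | e x z] = R :\ y.
  move=> xS; apply/eqP; rewrite eqEcard; apply/andP; split.
    apply/subsetP => z; rewrite inE in_setD1 => /andP[zR xz]; rewrite zR andbT.
    by apply: contraTneq xz => ->; apply: nyS.
  have := cardsD1 y R; rewrite yR cR add1n => -[<-].
  by have := degR x xS; rewrite /deg_in => ->.
have fyE z : z \in R -> (c z == c y) = (z == y).
  move=> zR; apply/eqP/eqP => [E'|-> //].
  have /cards1P[w Ew] : #|fib (c y)| == 1 by rewrite fy1.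
  have : z \in fib (c y) by rewrite inE zR E' eqxx.
  have : y \in fib (c y) by rewrite inE yR eqxx.
  by rewrite Ew => /set1P -> /set1P.
pose c' x := if x \in R then c x else c y.
have c'A x : c' x \in A by rewrite /c'; case: ifP => // xR; apply: cRA.
have RS x : x \notin R -> x \in S by rewrite inE negbK.
have eSR x z : x \in S -> z \in R -> e x z = (z != y).
  move=> xS zR; have : (z \in [set z in R | e x z]) = (z \in R :\ y) by rewrite NxR.
  by rewrite inE in_setD1 zR andbT.
have ce' x z : e x z = (c' x != c' z).
  rewrite /c'; case: (boolP (x \in R)) => xR; case: (boolP (z \in R)) => zR.
  - exact: ce.
  - by rewrite sym eSR ?RS // fyE.
  - by rewrite eSR ?RS // [c y == _]eq_sym fyE.
  rewrite eqxx; apply/negP => xz.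
  have : 0 < deg_in e S x by apply/card_gt0P; exists z; rewrite inE xz RS.
  by rewrite degS ?RS.
have fib' a : a \in A -> #|[set x | c' x == a]| = #|fib a| + (a == c y) * 5.
  move=> aA; rewrite -(cardsID R); congr (_ + _).
    apply: eq_card => x; rewrite inE [in RHS]inE [x \in finset _]inE andbC.
    by case: (boolP (x \in R)) => //= xR; rewrite /c' xR.
  have -> : [set x | c' x == a] :\: R = if a == c y then S else set0.
    apply/setP => x; rewrite in_setD inE /c'; case: (boolP (x \in R)) => /= xR.
      by case: ifP => _; [move: xR; rewrite in_setC => /negbTE ->|rewrite inE].
    by rewrite eq_sym; case: ifP => _; rewrite ?inE ?RS.
  by case: ifP => _; rewrite ?cS ?cards0.
pose D := [set a in A | #|fib a| == 2].
have fibD a : a \in A -> #|fib a| = 1 + (a \in D).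
  by move=> aA; rewrite inE aA /=; case: (cfib a aA) => h; rewrite /fib h.
have DA : D \subset A by apply/subsetP => a; rewrite inE => /andP[].
have cD : #|D| = 2.
  have : 6 = \sum_(a in A) #|fib a| by rewrite -cR -(sum_color cRA).
  rewrite (eq_bigr (fun a => 1 + (a \in D))) => [|a aA]; last exact: fibD.
  rewrite big_split /= sum_nat_const cA -big_mkcondr /= sum1_card.
  have -> : #|[pred a in A | a \in D]| = #|D|.
    by apply: eq_card => a; rewrite !inE andbA andbb.
  lia.
have /cards2P[d1 [d2 [d12 ED]]] : #|D| == 2 by rewrite cD.
have yD : c y \notin D by rewrite inE fy1 andbF.
have cyA := cRA y yR.
have /cards1P[z Ez] : #|(A :\: D) :\ c y| == 1.
  have := card_setD_sub DA; rewrite cA cD (cardsD1 (c y) (A :\: D)) in_setD yD cyA.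
  by move=> E4; apply/eqP; move: E4; lia.
have [zcy zD zA] : [/\ z != c y, z \notin D & z \in A].
  have : z \in (A :\: D) :\ c y by rewrite Ez set11.
  by rewrite in_setD1 in_setD => /and3P[].
have d1D : d1 \in D by rewrite ED set21.
have d2D : d2 \in D by rewrite ED set22.
have Al a : a \in A -> a \in [:: c y; d1; d2; z].
  move=> aA; rewrite !in_cons in_nil orbF.
  case: (boolP (a \in D)) => aD; first by move: aD; rewrite ED => /set2P[] ->; rewrite eqxx ?orbT.
  case: (eqVneq a (c y)) => //= acy.
  have : a \in (A :\: D) :\ c y by rewrite in_setD1 in_setD acy aD aA.
  by rewrite Ez => /set1P ->; rewrite eqxx !orbT.
have nyd d : d \in D -> c y != d by move=> dD; apply: contraNneq yD => ->.
have nzd d : d \in D -> d != z by move=> dD; apply: contraNneq zD => <-.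
apply: (@colored_isomorphic_K6221 G c' [:: c y; d1; d2; z]) => //.
- rewrite /= !in_cons !in_nil !orbF !negb_or (nyd _ d1D) (nyd _ d2D) (nzd _ d1D) (nzd _ d2D) d12.
  by rewrite [c y == z]eq_sym zcy.
- by move=> x; apply: Al.
move=> x; rewrite fib' //; have := Al _ (c'A x).
rewrite fibD // !in_cons in_nil orbF => /or4P[] /eqP ->.
- by rewrite (negbTE yD) /= eqxx.
- by rewrite d1D /= eq_sym (negbTE (nyd _ d1D)) eqxx.
- by rewrite d2D /= eq_sym (negbTE (nyd _ d2D)) (negbTE d12) eqxx.
rewrite (negbTE zD) /= (negbTE zcy) [c y == z]eq_sym (negbTE zcy).
by rewrite (negbTE (nzd _ d1D)) (negbTE (nzd _ d2D)) eqxx.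
Qed.

(** * Nonemptiness of $\mathcal{J}^k_{n,r}$ *)

Section TuranPlusVertex.
Variables (r m : nat) (N : pred 'I_m).

Definition plus_vertex_adj : rel (option 'I_m) := fun x y =>
  match x, y with
  | Some a, Some b => turan_adj r a b
  | Some a, None | None, Some a => N a
  | None, None => false
  end.

Fact plus_vertex_sym : symmetric plus_vertex_adj.
Proof. by move=> [a|] [b|] //=; apply: turan_sym. Qed.

Fact plus_vertex_irrefl : irreflexive plus_vertex_adj.
Proof. by move=> [a|] //=; apply: turan_irrefl. Qed.

Definition turan_plus_vertex : sgraph := SGraph plus_vertex_sym plus_vertex_irrefl.

End TuranPlusVertex.

(** Colouring the new vertex with the residue $r-1$, which its neighbours avoid, gives a proper
    $r$-colouring. *)
Lemma turan_plus_vertex_clique_free r m (N : pred 'I_m) : 0 < r ->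
  (forall x, N x -> x %% r != r.-1) -> clique_free r.+1 (turan_plus_vertex r N).
Proof.
move=> r0 NP S cS clS; have rp : r.-1 < r by rewrite ltn_predL.
pose g (x : turan_plus_vertex r N) : 'I_r :=
  if x is Some a then Ordinal (ltn_pmod a r0) else Ordinal rp.
have gadj x y : adj x y -> g x != g y.
  by case: x y => [a|] [b|] //= /NP; rewrite -val_eqE //= eq_sym.
have gi : {in S &, injective g}.
  move=> x y xS yS gxy; apply/eqP/negPn/negP => xy.
  by have := gadj x y (clS x y xS yS xy); rewrite gxy eqxx.
have := max_card (mem (g @: S)); rewrite card_ord card_in_imset // cS.
by rewrite ltnn.
Qed.

(** The new vertex is joined to [f 0], ..., [f k]. The residue of [f i] is [i %% s] with $s = r - 1
    \ge 2$, so consecutive ones are adjacent and the neighbourhood is traceable. *)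
Lemma in_J_exists n r k : 3 <= r -> large_order r k n -> exists J : sgraph, in_J k n r J.
Proof.
move=> r3 hn; have [h2r hk] := large_order_facts r3 hn.
have r0 : 0 < r by apply: leq_trans r3.
pose s := r.-1; have s2 : 2 <= s by rewrite /s; lia.
have s0 : 0 < s by lia.
have rE : r = s.+1 by rewrite /s prednK.
set m := n.-1 in hk; have m0 : 0 < m by rewrite /m; lia.
(* the first k + 1 vertices outside the last residue class *)
pose f i := i %/ s * r + i %% s.
have fE i : f i = i + i %/ s by have := divn_eq i s; rewrite /f rE mulnS; lia.
have fres i : f i %% r = i %% s.
  by rewrite /f modnMDl modn_small // rE ltnS ltnW // ltn_pmod.
have flt (i : 'I_k.+1) : f i < m.
  rewrite fE; apply: leq_ltn_trans hk; have ik : i <= k by rewrite -ltnS.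
  by apply: leq_add => //; apply: leq_div2r.
have finj i j : f i = f j -> i = j.
  rewrite !fE => E; have [ij|ij|//] := ltngtP i j.
    by have := leq_div2r s (ltnW ij); lia.
  by have := leq_div2r s (ltnW ij); lia.
pose phi (i : 'I_k.+1) : 'I_m := Ordinal (flt i).
have phi_inj : injective phi by move=> i j [] /finj /val_inj.
pose N : pred 'I_m := mem (codom phi).
have NP x : N x -> x %% r != r.-1.
  move=> /codomP[i ->] /=; rewrite fres -/s.
  by have := ltn_pmod i s0; case: eqP => // ->; rewrite ltnn.
pose J := turan_plus_vertex r N.
pose q : seq J := [seq Some (phi i) | i <- enum 'I_k.+1].
have qN : q =i neighbors (None : J).
  move=> [x|]; rewrite inE /=.
    by rewrite /q (map_comp Some) mem_map //; apply: Some_inj.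
  by apply/mapP => -[].
have uq : uniq q by rewrite map_inj_uniq ?enum_uniq // => i j [] /finj /val_inj.
have sq : size q = k.+1 by rewrite size_map size_enum_ord.
exists J; split.
- by rewrite card_option card_ord /m prednK //; lia.
- exact: turan_plus_vertex_clique_free.
exists None; split.
- pose y0 : 'I_m := Ordinal m0.
  pose g (x : induced [set~ (None : J)]) : 'I_m := if val x is Some a then a else y0.
  have gE x : Some (g x) = val x.
    by rewrite /g; case: x => -[a|] xP //=; move: (xP); rewrite !inE eqxx.
  exists g; last by move=> x y; rewrite /= /induced_adj -!gE.
  apply: inj_card_bij => [x y E|]; first by apply: val_inj; rewrite -!gE E.
  rewrite card_ord card_sig; apply: eq_leq.
  transitivity #|[set~ (None : J)]|; last exact: eq_card.
  by rewrite cardsC1 card_option card_ord.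
- by rewrite /degree -sq -(card_uniqP uq); apply: eq_card => x; rewrite qN.
apply: (@traceable_of_path J _ q) => //; first by rewrite -size_eq0 sq.
have : sorted (fun i j : nat => j == i.+1) (iota 0 k.+1).
  by apply/(sortedP 0) => i; rewrite size_iota => lt; rewrite !nth_iota ?add0n // ltnW.
rewrite -val_enum_ord sorted_map => h; rewrite sorted_map.
apply: (sub_sorted _ h) => i j /eqP /= Ej.
rewrite /turan_adj /= !fres Ej; apply/negP => /eqP E.
have := modn_small (_ : 1 < s) => // /(_ s2).
have : 1 = 0 %[mod s].
  by apply/eqP; rewrite -(eqn_modDl i) addn1 addn0 E.
by rewrite mod0n => ->.
Qed.

Theorem theorem4p5 (n r k : nat) (hr : 3 <= r)
    (hn : (order_bound r k <= n%:R)%R) :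
  (forall G : sgraph, #|G| = n -> clique_free r.+1 G ->
     ~ path_hamiltonian k G ->
     nb_edges G <= nb_edges (turan r n.-1) + k.+1 /\
     (nb_edges G = nb_edges (turan r n.-1) + k.+1 <->
      in_J k n r G \/ in_hatH (Posz k) n r G)) /\
  (exists J : sgraph, in_J k n r J).
Proof.
have large := order_bound_large hn; have r0 : 0 < r by apply: leq_trans hr.
split; last exact: in_J_exists.
move=> G cG cf /not_path_hamiltonian_path[p [pp szp nC]].
have [h2r _] := large_order_facts hr large.
have n3 : 2 < n by lia.
have conv : in_J k n r G \/ in_hatH (Posz k) n r G ->
    nb_edges G = nb_edges (turan r n.-1) + k.+1.
  case; first exact: in_J_nb_edges.
  rewrite turan_nb_edges // => -[a + iso]; clear -large iso.
  (* Of all listed triples only $(K_{6,2,2,1}, 4, 11)$ satisfies the order hypothesis, with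
     equality: $11 = 2 \cdot 4 + 3$. *)
  case: k large => [|[|[|[|[|[|[|k]]]]]]] large /=; rewrite ?inE ?xpair_eqE //.
  - case/or3P => /andP[/andP[/eqP Ea /eqP Er] /eqP En]; move: large; rewrite Er En // => _.
    rewrite (isomorphic_nb_edges iso) Ea nb_edges_K6221.
    by rewrite /turan_size !big_ord_recr big_ord0.
  - by case/or3P => /andP[/andP[_ /eqP Er] /eqP En]; move: large; rewrite Er En.
  - by case/or4P => /andP[/andP[_ /eqP Er] /eqP En]; move: large; rewrite Er En.
  - by case/andP => /andP[_ /eqP Er] /eqP En; move: large; rewrite Er En.
  - by case/orP => /andP[/andP[_ /eqP Er] /eqP En]; move: large; rewrite Er En.
  - by case/andP => /andP[_ /eqP Er] /eqP En; move: large; rewrite Er En.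
suff [le eqJ] : nb_edges G <= nb_edges (turan r n.-1) + k.+1 /\
    (nb_edges G = nb_edges (turan r n.-1) + k.+1 -> in_J k n r G \/ in_hatH (Posz k) n r G).
  by split=> //; split.
have /and3P[p0 sp up] := pp.
have [[v dv]|[s [s2 sn cS cS2]]] :=
    no_cycle_degrees cG (@adj_sym G) (@adj_irrefl G) n3 p0 sp up szp nC.
  have [le eqJ] := low_vertex_extremal cG hr large cf pp szp nC dv.
  by split=> // /eqJ; left.
pose W := [set x | deg (@adj G) x <= s + k].
have [S [SW cSs]] : exists S : {set G}, S \subset W /\ #|S| = s.
  exists [set x in take s (enum W)]; split.
    by apply/subsetP => x; rewrite inE => /mem_take; rewrite mem_enum.
  rewrite cardsE (card_uniqP (take_uniq _ (enum_uniq _))) size_takel //.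
  by rewrite -cardE.
have degS : \sum_(x in S) deg (@adj G) x <= s * (s + k).
  rewrite -cSs -sum_nat_const cSs; apply: leq_sum => x /(subsetP SW).
  by rewrite inE.
have cR : #|~: S| = n - s by rewrite cardsCs setCK cSs cG.
have nK := @clique_free_has_clique G r.+1 (~: S) cf.
have ub := turan_bound (@adj_sym G) (@adj_irrefl G) r0 nK.
rewrite cR in ub; have E := deg_sum_split S; rewrite turan_nb_edges //.
have leT : nb_edges G <= turan_size r (n - s) + s * (s + k) by lia.
have strict : nb_edges G < turan_size r n.-1 + k.+1 -> nb_edges G <= turan_size r n.-1 + k.+1 /\
    (nb_edges G = turan_size r n.-1 + k.+1 -> in_J k n r G \/ in_hatH (Posz k) n r G).
  by move=> lt; split=> [|Eq]; [exact: ltnW|move: lt; rewrite Eq ltnn].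
have [r5|r4] := leqP 5 r.
  by apply: strict; apply: leq_ltn_trans leT _; apply: turan_gap_r5.
have [Er|Er] : r = 4 \/ r = 3 by lia.
  rewrite Er in large *; have [lt|[En Ek Es]] := turan_gap_r4 large s2 sn.
    by rewrite Er in strict leT; apply: strict; apply: leq_ltn_trans lt.
  (* In the exceptional case both bounds agree: $13 + 5 \cdot 5 = 38 = e(T_4(10)) + 1$. *)
  have T10 : turan_size 4 10 + 1 = 38 by rewrite /turan_size !big_ord_recr big_ord0.
  have T6 : turan_size 4 6 = 13 by rewrite /turan_size !big_ord_recr big_ord0.
  rewrite Er En Ek Es T6 in leT; rewrite En Ek T10; split=> // Eq.
  right; exists [:: 6; 2; 2; 1] => //.
  apply: (@isomorphic_K6221 G S) => //.
  - by rewrite cG.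
  - by rewrite Er in cf.
  - by rewrite cSs.
  - by move=> x /(subsetP SW); rewrite inE Es Ek.
  (* The second degree count supplies the sixth low vertex: $n - k - s = 6$ vertices have degree at
     most $n - 1 - s = 5$. *)
  - by move: cS2; rewrite En Ek Es.
have cl (T : {set G}) x : T \subset ~: S -> x \in ~: S :|: S -> #|T| = 3 -> cliqueb (@adj G) T ->
    deg_in (@adj G) T x <= 2.
  move=> _ _ cT kT; have := @deg_in_clique_le _ _ (@adj_sym G) (@adj_irrefl G) setT T x.
  rewrite cT; apply; rewrite ?subsetT //.
  by rewrite Er in cf; apply: clique_free_has_clique.
have pack := triangle_packing_bound (@adj_sym G) (@adj_irrefl G) cl.
rewrite cR cSs in pack; have E2 := deg_sum_split_half S.
apply: strict; rewrite Er in large leT *.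
have [s2'|s3] := leqP s 2.
  have Es : s = 2 by lia.
  by rewrite Es in leT; apply: leq_ltn_trans leT (turan_gap_r3_s2 large).
have := turan_gap_r3 large s3 sn.
move: pack degS E2; rewrite -!mulnn; clear; lia.
Qed.
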